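(* There exist $T>0$, a uniformly continuous, weakly divergence-free velocity field $\widetilde V:[0,T]\times\mathbb{R}^2\to\mathbb{R}^2$, and a compact set $S\subset\mathbb{R}^2$ with $\dim_H S=2$, such that $\widetilde V$ admits a trajectory map $X_{\widetilde V}:[0,T]\times\mathbb{R}^2\to\mathbb{R}^2$ satisfying $\dim_H X_{\widetilde V}(t,S)=2$ for all $t\in[0,T)$ and $X_{\widetilde V}(T,S)=\{0\}$. Moreover, for every $t\in[0,T]$, $\widetilde V(t,\cdot)$ is locally Lipschitz on $\mathbb{R}^2\setminus\{(0,0)\}$.
   Context: Trajectory map: Given $U\in C([0,T]\times\mathbb{R}^d;\mathbb{R}^d)$ and $A\subset\mathbb{R}^d$, a map $X_U:[0,T]\times A\to\mathbb{R}^d$ is a trajectory map for $U$ on $A$ if for every $a\in A$ the map $t\mapsto X_U(t,a)$ is differentiable at all $t\in[0,T]$ and $\partial_tX_U(t,a)=U(t,X_U(t,a))$, $X_U(0,a)=a$. When $A$ is not specified, $A=\mathbb{R}^d$. $\dim_H$ denotes Hausdorff dimension. *)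

(* Defs.v *)
From Stdlib Require Import Reals Lra.
Open Scope R_scope.

Definition pt : Type := (R * R)%type.
Definition origin : pt := (0, 0).

Definition dist2 (p q : pt) : R :=
  sqrt ((fst p - fst q) ^ 2 + (snd p - snd q) ^ 2).

Definition open2 (U : pt -> Prop) : Prop :=
  forall p, U p -> exists r, 0 < r /\ forall q, dist2 p q < r -> U q.

Definition compact2 (S : pt -> Prop) : Prop :=
  forall (I : Type) (O : I -> pt -> Prop),
    (forall i, open2 (O i)) ->
    (forall p, S p -> exists i, O i p) ->
    exists l : list I, forall p, S p -> exists i, List.In i l /\ O i p.

Definition is_glb (E : R -> Prop) (m : R) : Prop :=
  (forall x, E x -> m <= x) /\ (forall b, (forall x, E x -> b <= x) -> b <= m).

Definition Hausdorff_null (s : R) (A : pt -> Prop) : Prop :=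
  forall delta eps, 0 < delta -> 0 < eps ->
  exists (U : nat -> pt -> Prop) (d : nat -> R),
    (forall n, 0 < d n <= delta /\
       forall p q, U n p -> U n q -> dist2 p q <= d n) /\
    (forall p, A p -> exists n, U n p) /\
    (forall N, sum_f_R0 (fun n => Rpower (d n) s) N <= eps).

Definition dimH_eq (A : pt -> Prop) (d : R) : Prop :=
  is_glb (fun s => 0 <= s /\ Hausdorff_null s A) d.

Definition image2 (f : pt -> pt) (A : pt -> Prop) : pt -> Prop :=
  fun p => exists a, A a /\ f a = p.

Definition unif_cont_on (T : R) (V : R -> pt -> pt) : Prop :=
  forall eps, 0 < eps -> exists delta, 0 < delta /\
    forall t s x y, 0 <= t <= T -> 0 <= s <= T ->
      Rabs (t - s) < delta -> dist2 x y < delta ->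
      dist2 (V t x) (V s y) < eps.

Definition has_deriv_within (T : R) (c : R -> pt) (t : R) (v : pt) : Prop :=
  forall eps, 0 < eps -> exists delta, 0 < delta /\
    forall h, h <> 0 -> Rabs h < delta -> 0 <= t + h <= T ->
      Rabs ((fst (c (t + h)) - fst (c t)) / h - fst v) < eps /\
      Rabs ((snd (c (t + h)) - snd (c t)) / h - snd v) < eps.

Definition trajectory_map (T : R) (U : R -> pt -> pt) (A : pt -> Prop)
    (X : R -> pt -> pt) : Prop :=
  forall a, A a ->
    X 0 a = a /\
    forall t, 0 <= t <= T -> has_deriv_within T (fun s => X s a) t (U t (X t a)).

Definition cont2 (g : R -> R -> R) : Prop :=
  forall x y eps, 0 < eps -> exists delta, 0 < delta /\
    forall x' y', Rabs (x' - x) < delta -> Rabs (y' - y) < delta ->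
      Rabs (g x' y' - g x y) < eps.

Definition smooth2 (f : R -> R -> R) (D : nat -> nat -> R -> R -> R) : Prop :=
  D 0%nat 0%nat = f /\
  forall i j,
    cont2 (D i j) /\
    (forall x y, derivable_pt_lim (fun s => D i j s y) x (D (S i) j x y)) /\
    (forall x y, derivable_pt_lim (fun s => D i j x s) y (D i (S j) x y)).

Definition RInt_eq (f : R -> R) (a b l : R) : Prop :=
  exists pr : Riemann_integrable f a b, RiemannInt pr = l.

(* weakly divergence-free: for each t in [0,T] and each test function
   phi in C_c^infinity(R^2) (support in [-Rs,Rs]^2),
   int_{R^2} V(t,x) . grad phi(x) dx = 0  (iterated Riemann integral). *)
Definition weakly_div_free (T : R) (V : R -> pt -> pt) : Prop :=
  forall (phi : R -> R -> R) (D : nat -> nat -> R -> R -> R) (Rs : R),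
    smooth2 phi D -> 0 < Rs ->
    (forall x y, Rs < Rabs x \/ Rs < Rabs y -> phi x y = 0) ->
    forall t, 0 <= t <= T ->
      exists inner : R -> R,
        (forall x, RInt_eq
           (fun y => fst (V t (x, y)) * D 1%nat 0%nat x y
                   + snd (V t (x, y)) * D 0%nat 1%nat x y)
           (- Rs) Rs (inner x)) /\
        RInt_eq inner (- Rs) Rs 0.

Definition loc_lipschitz_off0 (f : pt -> pt) : Prop :=
  forall p, p <> origin -> exists r L, 0 < r /\ 0 <= L /\
    forall x y, x <> origin -> y <> origin ->
      dist2 p x < r -> dist2 p y < r ->
      dist2 (f x) (f y) <= L * dist2 x y.

(* Main.v *)
Require Import Defs.
From Stdlib Require Import Reals Lra Lia Arith List.
From Stdlib Require Import Classical ClassicalEpsilon.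
From Coquelicot Require Import Coquelicot.
Open Scope R_scope.

(** A point is coded by binary digits [b 0, b 1, ...]: its abscissa is built from the even digits
    and its ordinate from the odd ones, digits [2i] and [2i+1] having weight [2^-i].  In the compact
    set the digits at the places [n^2 + 1] are forced to be [0].  These free places are so sparse that
    the dimension is still [2], yet each of them leaves a gap at all coarser scales, so that a digit
    is a Lipschitz function of the coordinate that contains it.

    The velocity performs a sequence of shears, the [m]-th one during [1 - (9/10)^m, 1 - (9/10)^(m+1)].
    The shears [2n] and [2n+1] first copy digit [n] to the place [n^2 + 1], which belongs to the other
    coordinate, and then use the copy to erase digit [n].  After [2n] shears all the digits before [n]
    vanish, hence the set collapses at time [1]; before that, the flow is a finite composition of
    bi-Lipschitz shears and preserves the dimension.  The displacement of the [m]-th shear is of order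
    [2^(-m/4)], which is much smaller than the time [(9/10)^m] it takes: the velocity
    tends to [0] and is uniformly continuous.  At each time it is a shear field, hence
    divergence-free and Lipschitz. *)

(** * Series *)

Fixpoint psum (a : nat -> R) (M : nat) : R :=
  match M with O => 0 | S k => psum a k + a k end.

Lemma sum_f_R0_psum a M : sum_f_R0 a M = psum a (S M).
Proof. induction M as [|M IH]; simpl in *; [ring | rewrite IH; ring]. Qed.

Lemma psum_ext a b M : (forall m, (m < M)%nat -> a m = b m) -> psum a M = psum b M.
Proof.
  induction M as [|M IH]; intros H; simpl; [reflexivity|].
  rewrite IH by (intros; apply H; lia). rewrite H by lia. reflexivity.
Qed.

Lemma psum_le a b M : (forall m, a m <= b m) -> psum a M <= psum b M.
Proof. intros H; induction M as [|M IH]; simpl; [lra | specialize (H M); lra]. Qed.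

Lemma psum_scal c a M : psum (fun m => c * a m) M = c * psum a M.
Proof. induction M as [|M IH]; simpl; [ring | rewrite IH; ring]. Qed.

Lemma is_lim_seq_psum a : ex_series a -> is_lim_seq (psum a) (Series a).
Proof.
  intros H. apply is_lim_seq_incr_1.
  apply is_lim_seq_ext with (sum_n a).
  - intros n. rewrite sum_n_Reals. apply sum_f_R0_psum.
  - exact (Series_correct a H).
Qed.

Lemma Series_split a M : ex_series a ->
  Series a = psum a M + Series (fun k => a (M + k)%nat).
Proof.
  intros H. destruct M as [|M].
  - simpl. rewrite Rplus_0_l. apply Series_ext; reflexivity.
  - rewrite (Series_incr_n a (S M)) by (lia || assumption).
    simpl Init.Nat.pred. rewrite sum_f_R0_psum. reflexivity.
Qed.

Lemma is_series_finite a M :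
  (forall m, (M <= m)%nat -> a m = 0) -> is_series a (psum a M).
Proof.
  intros H.
  assert (K : forall k, psum a (M + k) = psum a M).
  { induction k as [|k IH]; [now rewrite Nat.add_0_r|].
    rewrite Nat.add_succ_r. simpl. rewrite IH, H by lia. ring. }
  change (is_lim_seq (sum_n a) (psum a M)).
  apply (is_lim_seq_ext_loc (fun _ => psum a M)); [|apply is_lim_seq_const].
  exists M. intros n Hn. rewrite sum_n_Reals, sum_f_R0_psum.
  replace (S n) with (M + (S n - M))%nat by lia. symmetry; apply K.
Qed.

Lemma psum_single a M m : (m < M)%nat ->
  (forall k, (k < M)%nat -> k <> m -> a k = 0) -> psum a M = a m.
Proof.
  induction M as [|M IH]; intros Hm H; [lia|]. simpl.
  destruct (Nat.eq_dec m M) as [->|n].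
  - rewrite (psum_ext a (fun _ => 0) M) by (intros; apply H; lia).
    replace (psum (fun _ => 0) M) with 0; [ring|].
    clear; induction M as [|M IH]; simpl; [reflexivity | rewrite <- IH; ring].
  - rewrite IH by (lia || (intros; apply H; lia)). rewrite (H M) by lia. ring.
Qed.

Lemma Series_single a m : (forall k, k <> m -> a k = 0) -> Series a = a m.
Proof.
  intros H. rewrite (is_series_unique a (psum a (S m))).
  - apply psum_single; [lia | intros; now apply H].
  - apply is_series_finite. intros; apply H; lia.
Qed.

Lemma Series_Rabs_le a B : (forall m, Rabs (a m) <= B m) -> ex_series B ->
  Rabs (Series a) <= Series B.
Proof.
  intros H HB. eapply Rle_trans.
  - apply Series_Rabs. apply (ex_series_le (fun m => Rabs (a m)) B); [|exact HB].
    intros n. change (Rabs (Rabs (a n)) <= B n). now rewrite Rabs_Rabsolu.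
  - apply Series_le; [|exact HB]. intros n; split; [apply Rabs_pos | apply H].
Qed.

Lemma ex_series_dom a B : (forall m, Rabs (a m) <= B m) -> ex_series B -> ex_series a.
Proof. intros H HB. exact (ex_series_le a B H HB). Qed.

Lemma Series_tail_small B eps : ex_series B -> 0 < eps ->
  exists M, Rabs (Series (fun k => B (M + k)%nat)) < eps.
Proof.
  intros HB He. pose proof (is_lim_seq_psum B HB) as HL.
  apply is_lim_seq_spec in HL. destruct (HL (mkposreal eps He)) as [M HM].
  exists M. specialize (HM M (le_n M)). simpl in HM.
  rewrite (Series_split B M HB) in HM.
  rewrite <- Rabs_Ropp. eapply Rle_lt_trans; [|exact HM]. right; f_equal; ring.
Qed.

(* Dominated convergence for series, with [size i -> 0] as the limit. *)
Lemma Series_dominated_small {I : Type} (size : I -> R) (a : I -> nat -> R) (B : nat -> R) :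
  ex_series B ->
  (forall i m, Rabs (a i m) <= B m) ->
  (forall m eps, 0 < eps -> exists d, 0 < d /\ forall i, size i < d -> Rabs (a i m) < eps) ->
  forall eps, 0 < eps -> exists d, 0 < d /\ forall i, size i < d -> Rabs (Series (a i)) < eps.
Proof.
  intros HB Hdom Hsm eps He.
  (* The tail beyond [M] is below [eps / 2] for every [i] at once by domination. The head is a
     finite sum, where termwise smallness suffices. *)
  destruct (Series_tail_small B (eps / 2) HB) as [M HM]; [lra|].
  assert (Hfin : forall N e, 0 < e ->
    exists d, 0 < d /\ forall i, size i < d -> Rabs (psum (a i) N) < e).
  { induction N as [|N IH]; intros e Hpos.
    - exists 1; split; [lra|]. intros i _. simpl. now rewrite Rabs_R0.
    - destruct (IH (e / 2)) as [d1 [Hd1 H1]]; [lra|].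
      destruct (Hsm N (e / 2)) as [d2 [Hd2 H2]]; [lra|].
      exists (Rmin d1 d2); split; [now apply Rmin_pos|]. intros i Hi. simpl.
      specialize (H1 i (Rlt_le_trans _ _ _ Hi (Rmin_l _ _))).
      specialize (H2 i (Rlt_le_trans _ _ _ Hi (Rmin_r _ _))).
      eapply Rle_lt_trans; [apply Rabs_triang | lra]. }
  destruct (Hfin M (eps / 2)) as [d [Hd H]]; [lra|].
  exists d; split; [exact Hd|]. intros i Hi.
  rewrite (Series_split (a i) M) by (eapply ex_series_dom; eauto).
  assert (Ht : Rabs (Series (fun k => a i (M + k)%nat)) <= Series (fun k => B (M + k)%nat)).
  { apply Series_Rabs_le; [intros; apply Hdom|].
    now apply (ex_series_incr_n B M). }
  pose proof (Rle_abs (Series (fun k => B (M + k)%nat))).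
  specialize (H i Hi).
  eapply Rle_lt_trans; [apply Rabs_triang | lra].
Qed.

Lemma ex_series_Rscal c a : ex_series a -> ex_series (fun m => c * a m).
Proof. exact (ex_series_scal_l (K := R_AbsRing) (V := R_NormedModule) c a). Qed.

Lemma ex_series_Rminus a b : ex_series a -> ex_series b -> ex_series (fun m => a m - b m).
Proof. exact (ex_series_minus (K := R_AbsRing) (V := R_NormedModule) a b). Qed.

(** * Time profile *)

Definition pos (s : R) : R := Rmax 0 s.

Lemma pos_sq_derive s : is_derive (fun u => pos u ^ 2) s (2 * pos s).
Proof.
  apply is_derive_Reals. intros eps He.
  exists (mkposreal eps He). simpl. intros h Hh Hlt.
  (* The remainder is at most [h ^ 2] whatever the signs of [s] and [s + h], hence the choice of
     [eps] itself as radius. *)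
  assert (H : Rabs (pos (s + h) ^ 2 - pos s ^ 2 - h * (2 * pos s)) <= h ^ 2).
  { unfold pos, Rmax. apply Rabs_le.
    destruct (Rle_dec 0 s), (Rle_dec 0 (s + h)); split; nra. }
  replace ((pos (s + h) * (pos (s + h) * 1) - pos s * (pos s * 1)) / h - 2 * pos s)
    with ((pos (s + h) ^ 2 - pos s ^ 2 - h * (2 * pos s)) / h) by (field; exact Hh).
  unfold Rdiv. rewrite Rabs_mult, Rabs_inv.
  assert (Hp : 0 < Rabs h) by now apply Rabs_pos_lt.
  apply Rle_lt_trans with (h ^ 2 * / Rabs h).
  - apply Rmult_le_compat_r; [left; now apply Rinv_0_lt_compat | exact H].
  - rewrite <- (pow2_abs h). replace (Rabs h ^ 2 * / Rabs h) with (Rabs h) by (field; lra). lra.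
Qed.

(** A quadratic spline with knots 0, 1/2, 1. Its derivative is a tent of height 2 on [0,1]: it is
    Lipschitz and vanishes at both ends, so consecutive shears join continuously in time. *)
Definition smoothstep (s : R) : R :=
  2 * pos s ^ 2 - 4 * pos (s - 1/2) ^ 2 + 2 * pos (s - 1) ^ 2.

Definition smoothstep' (s : R) : R := 4 * pos s - 8 * pos (s - 1/2) + 4 * pos (s - 1).

Ltac pos_cases := unfold smoothstep, smoothstep', pos, Rmax;
  repeat match goal with |- context [Rle_dec ?a ?b] => destruct (Rle_dec a b) end.

Lemma smoothstep_derive s : is_derive smoothstep s (smoothstep' s).
Proof.
  assert (H : forall a, is_derive (fun u => pos (u - a) ^ 2) s (2 * pos (s - a))).
  { intros a. evar_last.
    - apply (is_derive_comp (fun u => pos u ^ 2) (fun u => u - a)); [apply pos_sq_derive|].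
      auto_derive; trivial.
    - unfold scal; simpl; unfold mult; simpl. ring. }
  pose proof (is_derive_scal _ _ 2 _ (pos_sq_derive s)) as H0.
  pose proof (is_derive_scal _ _ (-4) _ (H (1/2))) as H1.
  pose proof (is_derive_scal _ _ 2 _ (H 1)) as H2.
  pose proof (is_derive_plus _ _ _ _ _ (is_derive_plus _ _ _ _ _ H0 H1) H2) as H3.
  evar_last.
  - eapply is_derive_ext; [|exact H3]. intros u. unfold smoothstep, plus; simpl. ring.
  - unfold smoothstep', plus; simpl. ring.
Qed.

Lemma smoothstep_0 s : s <= 0 -> smoothstep s = 0.
Proof. intros; pos_cases; nra. Qed.

Lemma smoothstep_1 s : 1 <= s -> smoothstep s = 1.
Proof. intros; pos_cases; nra. Qed.

Lemma smoothstep_range s : 0 <= smoothstep s <= 1.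
Proof. pos_cases; split; nra. Qed.

Lemma smoothstep'_0 s : s <= 0 \/ 1 <= s -> smoothstep' s = 0.
Proof. intros; pos_cases; nra. Qed.

Lemma smoothstep'_bound s : Rabs (smoothstep' s) <= 2.
Proof. apply Rabs_le; pos_cases; split; lra. Qed.

Lemma pos_lipschitz a b : Rabs (pos a - pos b) <= Rabs (a - b).
Proof. unfold pos, Rmax, Rabs; repeat destruct Rle_dec; repeat destruct Rcase_abs; lra. Qed.

Lemma smoothstep'_lipschitz a b : Rabs (smoothstep' a - smoothstep' b) <= 16 * Rabs (a - b).
Proof.
  pose proof (pos_lipschitz a b).
  pose proof (pos_lipschitz (a - 1/2) (b - 1/2)).
  pose proof (pos_lipschitz (a - 1) (b - 1)).
  replace (a - 1/2 - (b - 1/2)) with (a - b) in * by ring.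
  replace (a - 1 - (b - 1)) with (a - b) in * by ring.
  unfold smoothstep'. revert H H0 H1.
  generalize (pos a) (pos b) (pos (a - 1/2)) (pos (b - 1/2)) (pos (a - 1)) (pos (b - 1)).
  intros; unfold Rabs in *; repeat destruct Rcase_abs; lra.
Qed.

Lemma smoothstep_lipschitz a b : Rabs (smoothstep a - smoothstep b) <= 2 * Rabs (a - b).
Proof.
  destruct (MVT_gen smoothstep b a smoothstep') as [c [_ E]].
  - intros; apply smoothstep_derive.
  - intros. apply derivable_continuous_pt. exists (smoothstep' x).
    apply is_derive_Reals, smoothstep_derive.
  - rewrite E, Rabs_mult. apply Rmult_le_compat_r; [apply Rabs_pos | apply smoothstep'_bound].
Qed.

(** * Time slots of the successive shears *)

Definition ratio : R := 9/10.
Definition tm (m : nat) : R := 1 - ratio ^ m.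
(** The length of the [m]-th slot. Its decay rate 9/10 is slower than the rate 2^(-1/4), about 0.84,
    of the displacements, so that displacement over duration is summable. *)
Definition tau (m : nat) : R := ratio ^ m / 10.

Lemma ratio_pow_pos m : 0 < ratio ^ m.
Proof. apply pow_lt; unfold ratio; lra. Qed.

Lemma tau_pos m : 0 < tau m.
Proof. unfold tau. pose proof (ratio_pow_pos m). lra. Qed.

Lemma tm_S m : tm (S m) = tm m + tau m.
Proof. unfold tm, tau; simpl; unfold ratio; field. Qed.

Lemma tm_0 : tm 0 = 0.
Proof. unfold tm; simpl; ring. Qed.

Lemma tm_le m n : (m <= n)%nat -> tm m <= tm n.
Proof.
  induction 1 as [|n _ IH]; [lra|]. rewrite tm_S. pose proof (tau_pos n). lra.
Qed.

Lemma tm_lt_1 m : tm m < 1.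
Proof. unfold tm. pose proof (ratio_pow_pos m). lra. Qed.

Lemma tm_locate t : 0 <= t < 1 -> exists m, tm m <= t < tm (S m).
Proof.
  intros [H0 H1].
  assert (HN : exists N, t < tm N).
  { destruct (pow_lt_1_zero ratio) with (y := 1 - t) as [N HN]; [unfold ratio; rewrite Rabs_pos_eq; lra | lra |].
    exists N. specialize (HN N (le_n N)). pose proof (ratio_pow_pos N).
    rewrite Rabs_pos_eq in HN by lra. unfold tm. lra. }
  destruct HN as [N HN]. induction N as [|N IH].
  - rewrite tm_0 in HN. lra.
  - destruct (Rlt_le_dec t (tm N)) as [h|h]; [now apply IH | now exists N].
Qed.

(** [Theta m t] is the fraction of the [m]-th shear performed by time [t]; [eta m] is its time
    derivative. *)
Definition Theta (m : nat) (t : R) : R := smoothstep ((t - tm m) / tau m).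
Definition eta (m : nat) (t : R) : R := smoothstep' ((t - tm m) / tau m) / tau m.

Lemma Theta_derive m t : is_derive (Theta m) t (eta m t).
Proof.
  unfold Theta, eta. evar_last.
  - apply (is_derive_comp smoothstep (fun u => (u - tm m) / tau m)); [apply smoothstep_derive|].
    auto_derive; trivial.
  - unfold scal; simpl; unfold mult; simpl. pose proof (tau_pos m). field; lra.
Qed.

Lemma Theta_before m t : t <= tm m -> Theta m t = 0.
Proof.
  intros H. apply smoothstep_0. pose proof (Rinv_0_lt_compat _ (tau_pos m)).
  unfold Rdiv; nra.
Qed.

Lemma Theta_after m t : tm (S m) <= t -> Theta m t = 1.
Proof.
  intros H. apply smoothstep_1. rewrite tm_S in H. pose proof (tau_pos m).
  apply Rmult_le_reg_r with (tau m); [lra|].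
  unfold Rdiv. rewrite Rmult_assoc, Rinv_l; lra.
Qed.

Lemma Theta_range m t : 0 <= Theta m t <= 1.
Proof. apply smoothstep_range. Qed.

Lemma eta_outside m t : t <= tm m \/ tm (S m) <= t -> eta m t = 0.
Proof.
  intros H. unfold eta. rewrite smoothstep'_0; [unfold Rdiv; ring|].
  rewrite tm_S in H. pose proof (tau_pos m). pose proof (Rinv_0_lt_compat _ (tau_pos m)).
  destruct H as [H|H]; [left; unfold Rdiv; nra | right].
  apply Rmult_le_reg_r with (tau m); [lra|].
  unfold Rdiv. rewrite Rmult_assoc, Rinv_l; lra.
Qed.

Lemma Rabs_div_tau x m : Rabs (x / tau m) = Rabs x / tau m.
Proof.
  unfold Rdiv. rewrite Rabs_mult, Rabs_inv, (Rabs_pos_eq (tau m)); [reflexivity|].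
  left; apply tau_pos.
Qed.

Lemma Rdiv_tau_le a b m : a <= b -> a / tau m <= b / tau m.
Proof.
  intros. apply Rmult_le_compat_r; [|assumption]. left; apply Rinv_0_lt_compat, tau_pos.
Qed.

Lemma Rdiv_tau_minus a b m : a / tau m - b / tau m = (a - b) / tau m.
Proof. unfold Rdiv; ring. Qed.

Lemma eta_bound m t : Rabs (eta m t) <= 2 / tau m.
Proof. unfold eta. rewrite Rabs_div_tau. apply Rdiv_tau_le, smoothstep'_bound. Qed.

Lemma eta_lipschitz m t s : Rabs (eta m t - eta m s) <= 16 / tau m / tau m * Rabs (t - s).
Proof.
  unfold eta. rewrite Rdiv_tau_minus, Rabs_div_tau.
  apply Rle_trans with (16 * Rabs ((t - tm m) / tau m - (s - tm m) / tau m) / tau m).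
  - apply Rdiv_tau_le, smoothstep'_lipschitz.
  - rewrite Rdiv_tau_minus, Rabs_div_tau. right.
    replace (t - tm m - (s - tm m)) with (t - s) by ring. pose proof (tau_pos m). field; lra.
Qed.

Lemma Theta_lipschitz m t s : Rabs (Theta m t - Theta m s) <= 2 / tau m * Rabs (t - s).
Proof.
  unfold Theta. eapply Rle_trans; [apply smoothstep_lipschitz|].
  rewrite Rdiv_tau_minus, Rabs_div_tau. right.
  replace (t - tm m - (s - tm m)) with (t - s) by ring. pose proof (tau_pos m). field; lra.
Qed.

Lemma eta_active m t : eta m t <> 0 -> tm m < t < tm (S m).
Proof.
  intros H. split; apply Rnot_le_lt; intros h; apply H, eta_outside; auto.
Qed.

(** The slots have disjoint interiors. This is what makes the velocity at a given time a single
    shear rather than a sum of shears in both directions. *)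
Lemma active_unique m n t : tm m < t < tm (S m) -> tm n < t < tm (S n) -> m = n.
Proof.
  intros H1 H2. destruct (lt_eq_lt_dec m n) as [[h|h]|h]; [|exact h|];
    pose proof (tm_le _ _ h); lra.
Qed.

(** * Binary digits *)

Definition b2r (b : bool) : R := if b then 1 else 0.

Lemma b2r_range b : 0 <= b2r b <= 1.
Proof. destruct b; simpl; lra. Qed.

Lemma half_pow_pos k : 0 < (1/2) ^ k.
Proof. apply pow_lt; lra. Qed.

Lemma half_pow_le i j : (i <= j)%nat -> (1/2) ^ j <= (1/2) ^ i.
Proof. induction 1 as [|j _ IH]; [lra|]. simpl. pose proof (half_pow_pos j). lra. Qed.

Definition val (c : nat -> bool) : R := Series (fun i => b2r (c i) * (1/2) ^ i).

Lemma ex_series_half : ex_series (fun i => (1/2) ^ i).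
Proof. apply ex_series_geom. rewrite Rabs_pos_eq; lra. Qed.

Lemma val_term_bound c i : Rabs (b2r (c i) * (1/2) ^ i) <= (1/2) ^ i.
Proof.
  pose proof (half_pow_pos i). pose proof (b2r_range (c i)).
  rewrite Rabs_pos_eq; nra.
Qed.

Lemma ex_series_val c : ex_series (fun i => b2r (c i) * (1/2) ^ i).
Proof. eapply ex_series_dom; [apply val_term_bound | apply ex_series_half]. Qed.

Definition drop1 (c : nat -> bool) : nat -> bool := fun i => c (S i).

Lemma val_drop1 c : val c = b2r (c O) + val (drop1 c) / 2.
Proof.
  unfold val. rewrite Series_incr_1 by apply ex_series_val. simpl. f_equal; [ring|].
  replace (Series (fun i => b2r (drop1 c i) * (1/2) ^ i) / 2)
    with (1/2 * Series (fun i => b2r (drop1 c i) * (1/2) ^ i)) by field.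
  rewrite <- Series_scal_l. apply Series_ext. intros i. unfold drop1. ring.
Qed.

Lemma val_range c : 0 <= val c <= 2.
Proof.
  split.
  - unfold val. apply Rle_trans with (Series (fun i => 0 * (b2r (c i) * (1/2) ^ i))).
    { rewrite Series_scal_l. lra. } apply Series_le; [|apply ex_series_val].
    intros i. pose proof (half_pow_pos i). pose proof (b2r_range (c i)). nra.
  - replace 2 with (Series (fun i => (1/2) ^ i)).
    + apply Series_le; [|apply ex_series_half].
      intros i. pose proof (half_pow_pos i). pose proof (b2r_range (c i)). nra.
    + rewrite Series_geom; [lra | rewrite Rabs_pos_eq; lra].
Qed.

Lemma val_gap k : forall c, c k = false -> val c <= 2 - (1/2) ^ k.
Proof.
  induction k as [|k IH]; intros c H; rewrite val_drop1.
  - rewrite H. simpl. pose proof (val_range (drop1 c)). lra.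
  - specialize (IH (drop1 c) H). pose proof (b2r_range (c O)). simpl. lra.
Qed.

(* A digit [k] that vanishes leaves a gap of size [2^-k] at all coarser scales. *)
Lemma val_separated k : forall j c c', (j < k)%nat -> c k = false -> c' k = false ->
  c j <> c' j -> (1/2) ^ k <= Rabs (val c - val c').
Proof.
  induction k as [|k IH]; intros j c c' Hj Hc Hc' Hne; [lia|].
  rewrite (val_drop1 c), (val_drop1 c').
  destruct (Bool.bool_dec (c O) (c' O)) as [e|n].
  - destruct j as [|j]; [congruence|].
    specialize (IH j (drop1 c) (drop1 c') ltac:(lia) Hc Hc' Hne).
    rewrite e.
    replace (b2r (c' O) + val (drop1 c) / 2 - (b2r (c' O) + val (drop1 c') / 2))
      with ((val (drop1 c) - val (drop1 c')) / 2) by field.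
    unfold Rdiv. rewrite Rabs_mult, (Rabs_pos_eq (/2)) by lra. simpl. lra.
  (* The first digits differ: one value is at least 1, while the other is at most half of
     [2 - (1/2) ^ k]. *)
  - pose proof (val_gap k (drop1 c) Hc). pose proof (val_gap k (drop1 c') Hc').
    pose proof (val_range (drop1 c)). pose proof (val_range (drop1 c')). simpl.
    destruct (c O), (c' O); simpl; try congruence; unfold Rabs; destruct Rcase_abs; lra.
Qed.

Lemma val_close k : forall c c', (forall i, (i < k)%nat -> c i = c' i) ->
  Rabs (val c - val c') <= 2 * (1/2) ^ k.
Proof.
  induction k as [|k IH]; intros c c' H.
  - pose proof (val_range c). pose proof (val_range c'). simpl. apply Rabs_le; lra.
  - rewrite (val_drop1 c), (val_drop1 c'), (H O) by lia.
    replace (b2r (c' O) + val (drop1 c) / 2 - (b2r (c' O) + val (drop1 c') / 2))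
      with ((val (drop1 c) - val (drop1 c')) / 2) by field.
    specialize (IH (drop1 c) (drop1 c') ltac:(intros; apply H; lia)).
    unfold Rdiv. rewrite Rabs_mult, (Rabs_pos_eq (/2)) by lra. simpl. lra.
Qed.

Definition upd (c : nat -> bool) (k : nat) (v : bool) : nat -> bool :=
  fun i => if Nat.eq_dec i k then v else c i.

Lemma val_ext c c' : (forall i, c i = c' i) -> val c = val c'.
Proof. intros H. apply Series_ext. intros i. now rewrite H. Qed.

Lemma val_upd k : forall c v, val (upd c k v) = val c + (b2r v - b2r (c k)) * (1/2) ^ k.
Proof.
  induction k as [|k IH]; intros c v; rewrite val_drop1, (val_drop1 c).
  - rewrite (val_ext (drop1 (upd c O v)) (drop1 c)) by reflexivity.
    unfold upd at 1. simpl. ring.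
  - rewrite (val_ext (drop1 (upd c (S k) v)) (upd (drop1 c) k v)).
    + rewrite IH. unfold upd at 1, drop1 at 2. simpl. field.
    + intros i. unfold drop1, upd.
      destruct (Nat.eq_dec (S i) (S k)), (Nat.eq_dec i k); congruence || lia || reflexivity.
Qed.

Lemma val_zero : val (fun _ => false) = 0.
Proof.
  unfold val. rewrite (is_series_unique _ (psum (fun i => b2r false * (1/2) ^ i) 0)).
  - reflexivity.
  - apply is_series_finite. intros; simpl; ring.
Qed.

Lemma val_small k c : (forall i, (i < k)%nat -> c i = false) -> val c <= 2 * (1/2) ^ k.
Proof.
  intros H. pose proof (val_close k c (fun _ => false) H) as h.
  rewrite val_zero, Rminus_0_r in h. pose proof (Rle_abs (val c)). lra.
Qed.

(* McShane extension of the indicator function of the complement of [Z]. *)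
Lemma lipschitz_separation (Z : R -> Prop) (d : R) : 0 < d ->
  exists h : R -> R, (forall x, 0 <= h x <= 1) /\
    (forall x y, Rabs (h x - h y) <= / d * Rabs (x - y)) /\
    (forall x, Z x -> h x = 0) /\
    (forall x, (forall z, Z z -> d <= Rabs (x - z)) -> h x = 1).
Proof.
  intros Hd.
  (* The supremum of [E x] is minus the distance to [Z], scaled by [/ d] and truncated at 1. The
     element -1 performs the truncation and keeps the set inhabited when [Z] is empty. *)
  set (E := fun x y => y <= 0 /\ (y = -1 \/ exists z, Z z /\ y = - (/ d * Rabs (x - z)))).
  assert (Hi : 0 < / d) by now apply Rinv_0_lt_compat.
  assert (HE : forall x, {m | is_lub (E x) m}).
  { intros x. apply completeness.
    - exists 0. intros y [Hy _]. exact Hy.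
    - exists (-1). split; [lra | now left]. }
  set (m := fun x => proj1_sig (HE x)).
  assert (Hm : forall x, is_lub (E x) (m x)) by (intros x; exact (proj2_sig (HE x))).
  assert (Hm1 : forall x, -1 <= m x <= 0).
  { intros x. destruct (Hm x) as [U L]. split.
    - apply U. split; [lra | now left].
    - apply L. intros y [Hy _]; exact Hy. }
  assert (HZ : forall x z, Z z -> - (/ d * Rabs (x - z)) <= m x).
  { intros x z Hz. destruct (Hm x) as [U _]. apply U.
    split; [pose proof (Rabs_pos (x - z)); nra|]. right; now exists z. }
  assert (HL : forall x y, m x - m y <= / d * Rabs (x - y)).
  { intros x y. apply Rplus_le_reg_r with (m y). ring_simplify (m x - m y + m y).
    destruct (Hm x) as [_ L]. apply L. intros v [Hv [->|[z [Hz ->]]]].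
    - pose proof (Rabs_pos (x - y)). specialize (Hm1 y). nra.
    - specialize (HZ y z Hz).
      assert (Rabs (y - z) <= Rabs (x - y) + Rabs (x - z)).
      { replace (y - z) with (- (x - y) + (x - z)) by ring.
        eapply Rle_trans; [apply Rabs_triang|]. rewrite Rabs_Ropp. lra. }
      nra. }
  exists (fun x => - m x). repeat split.
  - specialize (Hm1 x). lra.
  - specialize (Hm1 x). lra.
  - intros x y. pose proof (HL x y). pose proof (HL y x).
    rewrite (Rabs_minus_sym y x) in H0. apply Rabs_le. lra.
  - intros x Hx. specialize (HZ x x Hx). specialize (Hm1 x).
    replace (x - x) with 0 in HZ by ring. rewrite Rabs_R0 in HZ. lra.
  - intros x Hx. apply Rle_antisym; [specialize (Hm1 x); lra|].
    apply Ropp_le_cancel. rewrite Ropp_involutive. destruct (Hm x) as [_ L]. apply L.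
    intros v [_ [->|[z [Hz ->]]]]; [lra|]. specialize (Hx z Hz).
    assert (1 <= / d * Rabs (x - z)).
    { rewrite <- (Rinv_l d) by lra. nra. }
    lra.
Qed.

(** * Metrics on the plane *)

Definition dist1 (p q : pt) : R := Rabs (fst p - fst q) + Rabs (snd p - snd q).

Lemma dist2_le_dist1 p q : dist2 p q <= dist1 p q.
Proof.
  unfold dist2, dist1. pose proof (Rabs_pos (fst p - fst q)). pose proof (Rabs_pos (snd p - snd q)).
  rewrite <- (sqrt_pow2 (Rabs (fst p - fst q) + Rabs (snd p - snd q))) by lra. apply sqrt_le_1_alt.
  rewrite <- (pow2_abs (fst p - fst q)), <- (pow2_abs (snd p - snd q)). nra.
Qed.

(** The Boolean is the parity of the digits stored in that coordinate: even places in the abscissa,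
    odd ones in the ordinate. *)
Definition crd (c : bool) (p : pt) : R := if c then snd p else fst p.

Lemma crd_le_dist2 c p q : Rabs (crd c p - crd c q) <= dist2 p q.
Proof.
  unfold dist2. rewrite <- (sqrt_pow2 (Rabs _)) by apply Rabs_pos.
  apply sqrt_le_1_alt. rewrite pow2_abs.
  pose proof (pow2_ge_0 (fst p - fst q)). pose proof (pow2_ge_0 (snd p - snd q)).
  destruct c; unfold crd; lra.
Qed.

Lemma dist1_le_dist2 p q : dist1 p q <= 2 * dist2 p q.
Proof. pose proof (crd_le_dist2 false p q). pose proof (crd_le_dist2 true p q). unfold dist1; simpl in *; lra. Qed.

Lemma dist1_sym p q : dist1 p q = dist1 q p.
Proof. unfold dist1. rewrite (Rabs_minus_sym (fst p)), (Rabs_minus_sym (snd p)). reflexivity. Qed.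

Lemma dist1_triangle p q r : dist1 p r <= dist1 p q + dist1 q r.
Proof.
  unfold dist1.
  replace (fst p - fst r) with ((fst p - fst q) + (fst q - fst r)) by ring.
  replace (snd p - snd r) with ((snd p - snd q) + (snd q - snd r)) by ring.
  pose proof (Rabs_triang (fst p - fst q) (fst q - fst r)).
  pose proof (Rabs_triang (snd p - snd q) (snd q - snd r)). lra.
Qed.

Lemma pt_eq (p q : pt) : (forall c, crd c p = crd c q) -> p = q.
Proof.
  intros H. pose proof (H false). pose proof (H true). destruct p, q; simpl in *; congruence.
Qed.

(** * Shear fields *)

(** [d] names the coordinate that moves; the speed depends on the other one only, so the divergence
    vanishes. *)
Definition is_shear_field (v : pt -> pt) : Prop :=
  exists (d : bool) (g : R -> R) (K : R), 0 <= K /\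
    (forall x y, Rabs (g x - g y) <= K * Rabs (x - y)) /\
    (forall p, v p = if d then (0, g (fst p)) else (g (snd p), 0)).

Lemma shear_field_loc_lipschitz v : is_shear_field v -> loc_lipschitz_off0 v.
Proof.
  intros (d & g & K & HK & Hg & Hv) p _. exists 1, K. repeat split; [lra | exact HK|].
  intros x y _ _ _ _. rewrite !Hv. eapply Rle_trans; [apply dist2_le_dist1|].
  unfold dist1; destruct d; simpl; rewrite Rminus_diag, Rabs_R0, ?Rplus_0_l, ?Rplus_0_r;
    (eapply Rle_trans; [apply Hg | apply Rmult_le_compat_l; [exact HK|]]).
  - apply (crd_le_dist2 false).
  - apply (crd_le_dist2 true).
Qed.

Lemma is_RInt_RInt_eq f a b l : is_RInt f a b l -> RInt_eq f a b l.
Proof.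
  intros H. exists (ex_RInt_Reals_0 f a b (ex_intro _ l H)).
  rewrite <- RInt_Reals. now apply is_RInt_unique.
Qed.

Lemma cont2_continuity_2d f x y : cont2 f -> continuity_2d_pt f x y.
Proof.
  intros H [e He]. destruct (H x y e He) as [d [Hd h]]. exists (mkposreal d Hd). exact h.
Qed.

Lemma cont2_continuous_snd f x y : cont2 f -> continuous (f x) y.
Proof.
  intros H. apply continuity_pt_filterlim. intros e He.
  destruct (H x y e He) as [d [Hd h]]. exists d. split; [exact Hd|].
  intros z [_ Hz]. apply h; [now rewrite Rminus_diag, Rabs_R0 | exact Hz].
Qed.

Lemma lipschitz_continuous g K y : 0 <= K ->
  (forall a b, Rabs (g a - g b) <= K * Rabs (a - b)) -> continuous g y.
Proof.
  intros HK H. apply continuity_pt_filterlim. intros e He.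
  exists (e / (K + 1)). split; [apply Rdiv_lt_0_compat; lra|].
  intros z [_ Hz]. simpl in *. unfold R_dist in *. eapply Rle_lt_trans; [apply H|].
  assert (E : (K + 1) * (e / (K + 1)) = e) by (field; lra).
  pose proof (Rabs_pos (z - y)). nra.
Qed.

(** The support condition concerns points strictly outside the square. Continuity carries it to the
    boundary, where the integrals of derivatives are evaluated. *)
Lemma zero_at_boundary phi r : cont2 phi ->
  (forall x y, r < Rabs x \/ r < Rabs y -> phi x y = 0) ->
  forall x y, r <= Rabs x \/ r <= Rabs y -> phi x y = 0.
Proof.
  intros Hc H0 x y Hxy. apply NNPP; intros Hne.
  destruct (Hc x y (Rabs (phi x y))) as [d [Hd h]]; [now apply Rabs_pos_lt|].
  (* Pushing each coordinate away from 0 by [d / 2] leaves the closed exterior for the open one. *)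
  assert (Hout : forall z, exists z', Rabs (z' - z) < d /\ (r <= Rabs z -> r < Rabs z')).
  { intros z. exists (if Rle_dec 0 z then z + d / 2 else z - d / 2).
    destruct (Rle_dec 0 z); (split; [|intros]); unfold Rabs in *; repeat destruct Rcase_abs; lra. }
  destruct (Hout x) as [x' [Hx Hx']]. destruct (Hout y) as [y' [Hy Hy']].
  specialize (h x' y' Hx Hy). rewrite (H0 x' y') in h by tauto.
  rewrite Rminus_0_l, Rabs_Ropp in h. lra.
Qed.

Lemma shear_fields_div_free T V : (forall t, is_shear_field (V t)) -> weakly_div_free T V.
Proof.
  intros HV phi D r [HD0 HD] Hr Hsupp t _.
  destruct (HV t) as (d & g & K & HK & Hg & Hv).
  assert (Hc : forall i j, cont2 (D i j)) by (intros i j; apply HD).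
  assert (Hb : forall x y, r <= Rabs x \/ r <= Rabs y -> D O O x y = 0).
  { apply zero_at_boundary; [apply Hc | rewrite HD0; exact Hsupp]. }
  assert (Hrr : r <= Rabs r /\ r <= Rabs (- r)) by (rewrite Rabs_Ropp; pose proof (Rle_abs r); lra).
  destruct d.
  (* Vertical shear: [g x] is constant in the inner integral, which is then [g x] times the
     increment of the test function between two boundary points. *)
  - exists (fun _ => 0). split.
    + intros x. apply is_RInt_RInt_eq.
      apply is_RInt_ext with (fun y => g x * D O 1%nat x y).
      { intros y _. rewrite Hv. simpl. ring. }
      replace 0 with (minus (g x * D O O x r) (g x * D O O x (- r))).
      2:{ rewrite !Hb by tauto. unfold minus, plus, opp; simpl. ring. }
      apply (is_RInt_derive (fun y => g x * D O O x y)).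
      * intros y _. apply (is_derive_scal (D O O x)). apply is_derive_Reals, HD.
      * intros y _. apply (continuous_scal_r (g x) (D O 1%nat x)).
        now apply cont2_continuous_snd.
    + apply is_RInt_RInt_eq. pose proof (is_RInt_const (V := R_NormedModule) (- r) r 0) as h.
      unfold scal in h; simpl in h; unfold mult in h; simpl in h.
      rewrite Rmult_0_r in h. exact h.
  (* Horizontal shear: the inner integral is [G 1], the derivative of [G 0] by differentiation under
     the integral, and [G 0] vanishes at both ends. Treating all [i] together also yields continuity
     of [G 1], from its own differentiability. *)
  - set (G := (fun i x => RInt (fun y => g y * D i O x y) (- r) r) : nat -> R -> R).
    assert (Hcont : forall i x y, continuous (fun y => g y * D i O x y) y).
    { intros i x y. apply (continuous_mult g (D i O x)).
      - eapply lipschitz_continuous; eauto.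
      - now apply cont2_continuous_snd. }
    assert (Hder : forall i x y, is_derive (fun u => g y * D i O u y) x (g y * D (S i) O x y)).
    { intros i x y. apply (is_derive_scal (fun u => D i O u y)). apply is_derive_Reals, HD. }
    assert (HG : forall i x, is_derive (G i) x (G (S i) x)).
    { intros i x. unfold G.
      replace (RInt (fun y => g y * D (S i) O x y) (- r) r) with
        (RInt (fun y => Derive (fun u => g y * D i O u y) x) (- r) r).
      2:{ apply RInt_ext. intros y _. apply is_derive_unique, Hder. }
      apply (is_derive_RInt_param (fun u y => g y * D i O u y)).
      - apply filter_forall. intros u y _. eexists. apply Hder.
      - intros y _. apply continuity_2d_pt_ext with (fun u v => g v * D (S i) O u v).
        { intros u v. symmetry. apply is_derive_unique, Hder. }
        apply continuity_2d_pt_mult; [|now apply cont2_continuity_2d].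
        apply cont2_continuity_2d. intros a b e He.
        exists (e / (K + 1)). split; [apply Rdiv_lt_0_compat; lra|].
        intros a' b' _ Hz. eapply Rle_lt_trans; [apply Hg|].
        assert (E : (K + 1) * (e / (K + 1)) = e) by (field; lra).
        pose proof (Rabs_pos (b' - b)). nra.
      - apply filter_forall. intros u. apply (ex_RInt_continuous (V := R_CompleteNormedModule)). intros; apply Hcont. }
    exists (G 1%nat). split.
    + intros x. apply is_RInt_RInt_eq.
      apply is_RInt_ext with (fun y => g y * D 1%nat O x y).
      { intros y _. rewrite Hv. simpl. ring. }
      apply (RInt_correct (V := R_CompleteNormedModule)).
      apply (ex_RInt_continuous (V := R_CompleteNormedModule)). intros; apply Hcont.
    + apply is_RInt_RInt_eq.
      assert (HG0 : forall x, r <= Rabs x -> G O x = 0).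
      { intros x Hx. unfold G. rewrite (RInt_ext _ (fun _ => 0)).
        - rewrite RInt_const. apply Rmult_0_r.
        - intros y _. rewrite Hb by tauto. apply Rmult_0_r. }
      replace 0 with (minus (G O r) (G O (- r))).
      2:{ rewrite !HG0 by tauto. unfold minus, plus, opp; simpl. ring. }
      apply (is_RInt_derive (G O)).
      * intros x _. apply HG.
      * intros x _. apply (ex_derive_continuous (G 1%nat)). eexists. apply HG.
Qed.

(** * Flow of a sequence of shears *)

Definition mv (c : bool) (s : R) (p : pt) : pt :=
  if c then (fst p, snd p + s) else (fst p + s, snd p).

Lemma crd_mv c d s p : crd c (mv d s p) = crd c p + (if Bool.eqb d c then s else 0).
Proof. destruct c, d; simpl; ring. Qed.

Section Cascade.

(** The [m]-th shear moves coordinate [dir m] by [prof m] of the other coordinate. [A m] bounds the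
    displacement and [L m] is a Lipschitz constant, allowed to grow with [m]; up to a constant
    factor [A m / tau m] bounds the speed. *)
Variables (dir : nat -> bool) (prof : nat -> R -> R) (A L : nat -> R).
Hypothesis prof_bound : forall m z, Rabs (prof m z) <= A m.
Hypothesis prof_lipschitz : forall m z z', Rabs (prof m z - prof m z') <= L m * Rabs (z - z').
Hypothesis speed_summable : ex_series (fun m => A m / tau m).

Definition amount (m : nat) (p : pt) : R := prof m (crd (negb (dir m)) p).
Definition shear (m : nat) (s : R) (p : pt) : pt := mv (dir m) (s * amount m p) p.

Fixpoint stage (m : nat) (a : pt) : pt :=
  match m with O => a | S k => shear k 1 (stage k a) end.

Definition sel (m : nat) (c : bool) (x : R) : R := if Bool.eqb (dir m) c then x else 0.

(** A series over all shears instead of a case distinction on the current slot: at most one term is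
    nonzero, and time 1, where all terms vanish, gets the same treatment as any other time. *)
Definition velocity (t : R) (p : pt) : pt :=
  (Series (fun m => sel m false (eta m t * amount m p)),
   Series (fun m => sel m true (eta m t * amount m p))).

(** Each displacement is evaluated at [stage m a], the position at the start of the [m]-th slot. The
    formula thus stays explicit and makes sense at time 1, after infinitely many shears. *)
Definition flow (t : R) (a : pt) : pt :=
  (fst a + Series (fun m => sel m false (Theta m t * amount m (stage m a))),
   snd a + Series (fun m => sel m true (Theta m t * amount m (stage m a)))).

Lemma crd_velocity c t p :
  crd c (velocity t p) = Series (fun m => sel m c (eta m t * amount m p)).
Proof. destruct c; reflexivity. Qed.

Lemma crd_flow c t a :
  crd c (flow t a) = crd c a + Series (fun m => sel m c (Theta m t * amount m (stage m a))).
Proof. destruct c; reflexivity. Qed.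

Lemma sel_abs m c x y : 0 <= y -> Rabs x <= y -> Rabs (sel m c x) <= y.
Proof. unfold sel; destruct Bool.eqb; [trivial | intros; rewrite Rabs_R0; lra]. Qed.

Lemma A_nonneg m : 0 <= A m.
Proof. eapply Rle_trans; [apply Rabs_pos | apply (prof_bound m 0)]. Qed.

Lemma speed_nonneg m : 0 <= A m / tau m.
Proof. pose proof (A_nonneg m). pose proof (Rinv_0_lt_compat _ (tau_pos m)). unfold Rdiv; nra. Qed.

Lemma A_le_speed m : A m <= A m / tau m.
Proof.
  pose proof (A_nonneg m). pose proof (tau_pos m).
  apply Rmult_le_reg_r with (tau m); [lra|].
  unfold Rdiv; rewrite Rmult_assoc, Rinv_l by lra.
  assert (tau m <= 1); [|nra]. pose proof (tm_lt_1 (S m)). rewrite tm_S in H1.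
  pose proof (tm_le 0 m ltac:(lia)). rewrite tm_0 in H2. lra.
Qed.

Lemma crd_stage c a M :
  crd c (stage M a) = crd c a + psum (fun m => sel m c (amount m (stage m a))) M.
Proof.
  induction M as [|M IH]; simpl; [ring|].
  unfold shear. rewrite crd_mv, IH. unfold sel at 3. rewrite Rmult_1_l. ring.
Qed.

(** In the [m]-th slot the earlier terms are complete and add up to [stage m a], while the later
    ones have not begun. *)
Lemma flow_on_stage m t a : tm m <= t <= tm (S m) ->
  flow t a = shear m (Theta m t) (stage m a).
Proof.
  intros Ht. apply pt_eq. intros c. rewrite crd_flow.
  rewrite (is_series_unique _ (psum (fun k => sel k c (Theta k t * amount k (stage k a))) (S m))).
  - simpl. rewrite (psum_ext _ (fun k => sel k c (amount k (stage k a)))).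
    + unfold shear. rewrite crd_mv, crd_stage. unfold sel at 2. ring.
    + intros k Hk. rewrite Theta_after; [now rewrite Rmult_1_l|].
      pose proof (tm_le (S k) m Hk). lra.
  - apply is_series_finite. intros k Hk. rewrite Theta_before.
    + rewrite Rmult_0_l. unfold sel; destruct Bool.eqb; reflexivity.
    + pose proof (tm_le (S m) k Hk). lra.
Qed.

Lemma amount_shear m s p : amount m (shear m s p) = amount m p.
Proof.
  unfold amount at 1, shear. rewrite crd_mv.
  replace (if Bool.eqb (dir m) (negb (dir m)) then s * amount m p else 0) with 0
    by (destruct (dir m); reflexivity).
  now rewrite Rplus_0_r.
Qed.

(** While the [m]-th shear acts, the coordinate it reads does not move. Its speed along a trajectory
    is therefore frozen at the starting value, and the termwise derivative of [flow] is [velocity]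
    along [flow]. *)
Lemma eta_amount_flow m t a : eta m t * amount m (flow t a) = eta m t * amount m (stage m a).
Proof.
  destruct (Req_dec (eta m t) 0) as [->|n]; [ring|].
  pose proof (eta_active m t n). rewrite (flow_on_stage m t a) by lra.
  now rewrite amount_shear.
Qed.

Lemma ex_series_flow c t a : ex_series (fun m => sel m c (Theta m t * amount m (stage m a))).
Proof.
  eapply ex_series_dom; [|exact speed_summable]. intros m.
  apply sel_abs; [apply speed_nonneg|]. rewrite Rabs_mult.
  pose proof (Theta_range m t). rewrite (Rabs_pos_eq (Theta m t)) by lra.
  pose proof (A_le_speed m). pose proof (prof_bound m (crd (negb (dir m)) (stage m a))).
  pose proof (Rabs_pos (amount m (stage m a))). unfold amount in *. nra.
Qed.

Lemma eta_amount_bound m t p : Rabs (eta m t * amount m p) <= 2 * (A m / tau m).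
Proof.
  rewrite Rabs_mult. replace (2 * (A m / tau m)) with (2 / tau m * A m) by (unfold Rdiv; ring).
  apply Rmult_le_compat; try apply Rabs_pos; [apply eta_bound | apply prof_bound].
Qed.

Lemma ex_series_velocity c t p : ex_series (fun m => sel m c (eta m t * amount m p)).
Proof.
  eapply ex_series_dom.
  - intros m. apply sel_abs; [|apply (eta_amount_bound m t p)].
    pose proof (speed_nonneg m); lra.
  - apply (ex_series_Rscal 2); exact speed_summable.
Qed.

Lemma flow_0 a : flow 0 a = a.
Proof.
  rewrite (flow_on_stage 0).
  - rewrite Theta_before by (rewrite tm_0; lra). simpl. apply pt_eq; intros c.
    unfold shear. rewrite crd_mv, Rmult_0_l. destruct Bool.eqb; ring.
  - pose proof (tm_le 0 1 ltac:(lia)). rewrite tm_0 in *. lra.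
Qed.

Lemma flow_displacement : exists C, forall c t a, Rabs (crd c (flow t a) - crd c a) <= C.
Proof.
  exists (Series (fun m => A m / tau m)). intros c t a. rewrite crd_flow.
  match goal with |- Rabs (?x + ?y - ?x) <= _ => replace (x + y - x) with y by ring end.
  apply Series_Rabs_le; [|exact speed_summable]. intros m.
  apply sel_abs; [apply speed_nonneg|]. rewrite Rabs_mult.
  pose proof (Theta_range m t). rewrite (Rabs_pos_eq (Theta m t)) by lra.
  pose proof (A_le_speed m). pose proof (prof_bound m (crd (negb (dir m)) (stage m a))).
  pose proof (Rabs_pos (amount m (stage m a))). unfold amount in *. nra.
Qed.

(** Termwise differentiation by dominated convergence: the difference quotient of [Theta m] and its
    derivative are both at most [2 / tau m], whence the bound [4 * (A m / tau m)]. The argument is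
    uniform in [t] and includes the collapse time. *)
Lemma flow_derivative c t a eps : 0 < eps -> exists delta, 0 < delta /\
  forall h, h <> 0 -> Rabs h < delta ->
    Rabs ((crd c (flow (t + h) a) - crd c (flow t a)) / h - crd c (velocity t (flow t a))) < eps.
Proof.
  intros He. rewrite crd_velocity.
  set (D := fun (i : {h : R | h <> 0}) m => let h := proj1_sig i in
    sel m c (((Theta m (t + h) - Theta m t) / h - eta m t) * amount m (stage m a))).
  destruct (Series_dominated_small (fun i : {h : R | h <> 0} => Rabs (proj1_sig i)) D
    (fun m => 4 * (A m / tau m))) with (eps := eps) as [d [Hd H]]; try assumption.
  - apply (ex_series_Rscal 4); exact speed_summable.
  - intros [h Hh] m. unfold D; simpl. apply sel_abs; [pose proof (speed_nonneg m); lra|].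
    rewrite Rabs_mult. replace (4 * (A m / tau m)) with (4 / tau m * A m) by (unfold Rdiv; ring).
    apply Rmult_le_compat; try apply Rabs_pos; [|apply prof_bound].
    unfold Rminus at 1. eapply Rle_trans; [apply Rabs_triang|]. rewrite Rabs_Ropp.
    pose proof (eta_bound m t). pose proof (Theta_lipschitz m (t + h) t) as HT.
    replace (t + h - t) with h in HT by ring.
    assert (Hp : 0 < Rabs h) by now apply Rabs_pos_lt.
    assert (Rabs ((Theta m (t + h) - Theta m t) / h) <= 2 / tau m).
    { unfold Rdiv at 1. rewrite Rabs_mult, Rabs_inv.
      apply Rmult_le_reg_r with (Rabs h); [lra|]. rewrite Rmult_assoc, Rinv_l by lra. lra. }
    unfold Rdiv in *. lra.
  - intros m e Hpos. pose proof (Theta_derive m t) as HD. apply is_derive_Reals in HD.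
    assert (Ha : 0 < A m + 1) by (pose proof (A_nonneg m); lra).
    destruct (HD (e / (A m + 1))) as [[d Hd] Hlt]; [now apply Rdiv_lt_0_compat|].
    exists d; split; [exact Hd|]. intros [h Hh] Hs. simpl in Hs. unfold D; simpl.
    specialize (Hlt h Hh Hs). unfold sel. destruct Bool.eqb; [|rewrite Rabs_R0; lra].
    rewrite Rabs_mult. pose proof (prof_bound m (crd (negb (dir m)) (stage m a))) as Hb.
    fold (amount m (stage m a)) in Hb.
    apply Rle_lt_trans with (Rabs ((Theta m (t + h) - Theta m t) / h - eta m t) * (A m)).
    + apply Rmult_le_compat_l; [apply Rabs_pos | exact Hb].
    + apply Rle_lt_trans with (e / (A m + 1) * A m).
      * apply Rmult_le_compat_r; [apply A_nonneg | lra].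
      * apply Rmult_lt_reg_r with (A m + 1); [lra|].
        replace (e / (A m + 1) * A m * (A m + 1)) with (e * A m) by (field; lra). nra.
  - exists d; split; [exact Hd|]. intros h Hh Hs. specialize (H (exist _ h Hh) Hs).
    eapply Rle_lt_trans; [right | exact H]. f_equal. rewrite 2!crd_flow.
    rewrite (Series_ext (fun m => sel m c (eta m t * amount m (flow t a)))
      (fun m => sel m c (eta m t * amount m (stage m a))))
      by (intros m; now rewrite eta_amount_flow).
    match goal with |- (?x + ?y - (?x + ?z)) / h - ?w = _ =>
      replace ((x + y - (x + z)) / h - w) with (/ h * (y - z) - w) by (field; exact Hh) end.
    rewrite <- Series_minus, <- Series_scal_l, <- Series_minus; try apply ex_series_flow.
    + apply Series_ext. intros m. unfold D, sel; simpl. destruct Bool.eqb; field; exact Hh.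
    + apply (ex_series_Rscal (/ h)).
      apply ex_series_Rminus; apply ex_series_flow.
    + apply (ex_series_ext (fun m => sel m c (eta m t * amount m (flow t a)))).
      * intros m. now rewrite eta_amount_flow.
      * apply ex_series_velocity.
Qed.

Lemma flow_trajectory T (D : pt -> Prop) : trajectory_map T velocity D flow.
Proof.
  intros a _. split; [apply flow_0|]. intros t _ eps He.
  destruct (flow_derivative false t a eps He) as [d [Hd H]].
  destruct (flow_derivative true t a eps He) as [d' [Hd' H']].
  exists (Rmin d d'); split; [now apply Rmin_pos|]. intros h Hh Hs _. split.
  - apply H; [exact Hh|]. eapply Rlt_le_trans; [exact Hs | apply Rmin_l].
  - apply H'; [exact Hh|]. eapply Rlt_le_trans; [exact Hs | apply Rmin_r].
Qed.

Lemma L_nonneg m : 0 <= L m.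
Proof.
  pose proof (prof_lipschitz m 1 0). rewrite Rminus_0_r, Rabs_R1 in H.
  pose proof (Rabs_pos (prof m 1 - prof m 0)). lra.
Qed.

(** Each term is Lipschitz in time and space, with constants that may blow up with [m]; summable
    domination of the terms makes the modulus of continuity of the sum uniform nevertheless. *)
Lemma velocity_uniform c eps : 0 < eps -> exists delta, 0 < delta /\
  forall t s x y, Rabs (t - s) < delta -> dist2 x y < delta ->
    Rabs (crd c (velocity t x) - crd c (velocity s y)) < eps.
Proof.
  intros He.
  set (D := fun (i : R * R * (pt * pt)) m => let '((t, s), (x, y)) := i in
    sel m c (eta m t * amount m x - eta m s * amount m y)).
  set (size := fun i : R * R * (pt * pt) => let '((t, s), (x, y)) := i in
    Rmax (Rabs (t - s)) (dist2 x y)).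
  destruct (Series_dominated_small size D (fun m => 4 * (A m / tau m))) with (eps := eps)
    as [d [Hd H]]; try assumption.
  - apply (ex_series_Rscal 4); exact speed_summable.
  - intros [[t s] [x y]] m. unfold D. apply sel_abs; [pose proof (speed_nonneg m); lra|].
    unfold Rminus. eapply Rle_trans; [apply Rabs_triang|]. rewrite Rabs_Ropp.
    pose proof (eta_amount_bound m t x). pose proof (eta_amount_bound m s y). lra.
  - intros m e Hpos. pose proof (tau_pos m) as Ht.
    assert (K1 : 0 <= 16 / tau m / tau m) by (repeat apply Rdiv_le_0_compat; lra).
    assert (K2 : 0 <= 2 / tau m) by (apply Rdiv_le_0_compat; lra).
    pose proof (L_nonneg m) as HL. pose proof (A_nonneg m) as HA.
    (* The Lipschitz constants of the [m]-th term in time and in space; the summand 1 makes [K]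
       positive and the final inequality strict. *)
    set (K := 16 / tau m / tau m * A m + 2 / tau m * L m + 1).
    assert (HK : 0 < K) by (unfold K; nra).
    exists (e / K). split; [now apply Rdiv_lt_0_compat|]. intros [[t s] [x y]] Hs. simpl in Hs.
    assert (Hts : Rabs (t - s) < e / K) by (eapply Rle_lt_trans; [apply Rmax_l | exact Hs]).
    assert (Hxy : dist2 x y < e / K) by (eapply Rle_lt_trans; [apply Rmax_r | exact Hs]).
    assert (He' : 0 < e / K) by now apply Rdiv_lt_0_compat.
    unfold D, sel. destruct Bool.eqb; [|rewrite Rabs_R0; lra].
    replace (eta m t * amount m x - eta m s * amount m y) with
      ((eta m t - eta m s) * amount m x + eta m s * (amount m x - amount m y)) by ring.
    eapply Rle_lt_trans; [apply Rabs_triang|]. rewrite !Rabs_mult.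
    assert (B1 : Rabs (eta m t - eta m s) * Rabs (amount m x) <= 16 / tau m / tau m * (e / K) * A m).
    { apply Rmult_le_compat; try apply Rabs_pos; [|apply prof_bound].
      eapply Rle_trans; [apply eta_lipschitz|]. apply Rmult_le_compat_l; lra. }
    assert (B2 : Rabs (eta m s) * Rabs (amount m x - amount m y) <= 2 / tau m * (L m * (e / K))).
    { apply Rmult_le_compat; try apply Rabs_pos; [apply eta_bound|].
      eapply Rle_trans; [apply prof_lipschitz|]. apply Rmult_le_compat_l; [exact HL|].
      pose proof (crd_le_dist2 (negb (dir m)) x y). lra. }
    assert (E : K * (e / K) = e) by (field; lra). set (z := e / K) in *. clearbody z.
    rewrite <- E. unfold K. nra.
  - exists d; split; [exact Hd|]. intros t s x y Hts Hxy.
    specialize (H (t, s, (x, y)) (Rmax_lub_lt _ _ _ Hts Hxy)).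
    eapply Rle_lt_trans; [right | exact H]. f_equal. rewrite 2!crd_velocity.
    rewrite <- Series_minus by apply ex_series_velocity.
    apply Series_ext. intros m. unfold D, sel. destruct Bool.eqb; ring.
Qed.

Lemma velocity_unif_cont T : unif_cont_on T velocity.
Proof.
  intros eps He.
  destruct (velocity_uniform false (eps / 2)) as [d [Hd H]]; [lra|].
  destruct (velocity_uniform true (eps / 2)) as [d' [Hd' H']]; [lra|].
  exists (Rmin d d'); split; [now apply Rmin_pos|]. intros t s x y _ _ Hts Hxy.
  pose proof (Rmin_l d d'). pose proof (Rmin_r d d').
  specialize (H t s x y ltac:(lra) ltac:(lra)). specialize (H' t s x y ltac:(lra) ltac:(lra)).
  eapply Rle_lt_trans; [apply dist2_le_dist1|]. unfold dist1. simpl in *. lra.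
Qed.

Lemma velocity_is_shear t : is_shear_field (velocity t).
Proof.
  destruct (classic (exists m, eta m t <> 0)) as [[m Hm]|Hno].
  - exists (dir m), (fun z => eta m t * prof m z), (Rabs (eta m t) * L m). repeat split.
    + apply Rmult_le_pos; [apply Rabs_pos | apply L_nonneg].
    + intros x y. rewrite <- Rmult_minus_distr_l, Rabs_mult, Rmult_assoc.
      apply Rmult_le_compat_l; [apply Rabs_pos | apply prof_lipschitz].
    + intros p. apply pt_eq. intros c. rewrite crd_velocity, (Series_single _ m).
      * unfold sel, amount. destruct c, (dir m); reflexivity.
      * intros k Hk. destruct (Req_dec (eta k t) 0) as [->|n].
        -- unfold sel; destruct Bool.eqb; ring.
        -- destruct Hk. apply (active_unique _ _ t); now apply eta_active.
  (* Between slots and from time 1 on, no shear is active and the field is zero. *)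
  - exists true, (fun _ => 0), 0. repeat split; [lra | |].
    + intros. rewrite Rminus_diag, Rabs_R0. lra.
    + intros p. apply pt_eq. intros c. rewrite crd_velocity, (Series_single _ 0%nat).
      * replace (eta 0 t) with 0 by (symmetry; apply NNPP; intros h; apply Hno; eauto).
        unfold sel. destruct c, Bool.eqb; simpl; ring.
      * intros k _. replace (eta k t) with 0 by (symmetry; apply NNPP; intros h; apply Hno; eauto).
        unfold sel; destruct Bool.eqb; ring.
Qed.

(** The coordinate that is read stays fixed, so the separation in the moving coordinate is recovered
    up to [L m] times the separation in the fixed one. *)
Lemma shear_inverse_lipschitz m s p p' : 0 <= s <= 1 ->
  dist1 p p' <= (1 + L m) * dist1 (shear m s p) (shear m s p').
Proof.
  intros Hs. unfold dist1, shear, amount. pose proof (L_nonneg m) as HL.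
  pose proof (prof_lipschitz m (crd (negb (dir m)) p) (crd (negb (dir m)) p')) as HP.
  destruct (dir m); simpl in *;
  [set (u := prof m (fst p)) in *; set (u' := prof m (fst p')) in *;
   assert (Hu : Rabs (snd p - snd p') <= Rabs (snd p + s * u - (snd p' + s * u')) + Rabs (u - u'))
  |set (u := prof m (snd p)) in *; set (u' := prof m (snd p')) in *;
   assert (Hu : Rabs (fst p - fst p') <= Rabs (fst p + s * u - (fst p' + s * u')) + Rabs (u - u'))];
  try (match goal with |- Rabs ?x <= Rabs ?y + _ =>
    replace x with (y + - (s * (u - u'))) by ring end;
    eapply Rle_trans; [apply Rabs_triang|]; rewrite Rabs_Ropp, Rabs_mult, (Rabs_pos_eq s) by lra;
    pose proof (Rabs_pos (u - u')); nra).
  - pose proof (Rabs_pos (snd p + s * u - (snd p' + s * u'))).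
    pose proof (Rabs_pos (fst p - fst p')). nra.
  - pose proof (Rabs_pos (fst p + s * u - (fst p' + s * u'))).
    pose proof (Rabs_pos (snd p - snd p')). nra.
Qed.

Lemma stage_inverse_lipschitz m : exists K, 0 < K /\
  forall a b, dist1 a b <= K * dist1 (stage m a) (stage m b).
Proof.
  induction m as [|m [K [HK IH]]].
  - exists 1. split; [lra|]. intros; simpl; lra.
  - pose proof (L_nonneg m). exists (K * (1 + L m)). split; [nra|]. intros a b.
    eapply Rle_trans; [apply IH|]. rewrite Rmult_assoc. apply Rmult_le_compat_l; [lra|].
    apply shear_inverse_lipschitz. lra.
Qed.

(** Before time 1 only finitely many shears have begun, so the inverse bounds multiply to a finite
    constant, depending on [t]. It serves to pull covers of the image back to the initial set. *)
Lemma flow_inverse_lipschitz t : 0 <= t < 1 -> exists K, 0 < K /\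
  forall a b, dist1 a b <= K * dist1 (flow t a) (flow t b).
Proof.
  intros Ht. destruct (tm_locate t Ht) as [m Hm].
  destruct (stage_inverse_lipschitz m) as [K [HK H]].
  pose proof (L_nonneg m). exists (K * (1 + L m)). split; [nra|]. intros a b.
  rewrite 2!(flow_on_stage m) by lra.
  eapply Rle_trans; [apply H|]. rewrite Rmult_assoc. apply Rmult_le_compat_l; [lra|].
  apply shear_inverse_lipschitz. apply Theta_range.
Qed.

Lemma flow_terminal c a : is_lim_seq (fun m => crd c (stage m a)) (crd c (flow 1 a)).
Proof.
  rewrite crd_flow.
  apply is_lim_seq_ext with
    (fun M => crd c a + psum (fun m => sel m c (Theta m 1 * amount m (stage m a))) M).
  - intros M. rewrite crd_stage. f_equal. apply psum_ext. intros m _.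
    rewrite Theta_after, Rmult_1_l; [reflexivity|]. pose proof (tm_lt_1 (S m)). lra.
  - apply (is_lim_seq_plus' (fun _ => crd c a)); [apply is_lim_seq_const|].
    apply is_lim_seq_psum, ex_series_flow.
Qed.

End Cascade.

(** * Digit dynamics *)

(** The parity of [n * n + 1] is opposite to that of [n]: the copy of digit [n] lands in the other
    coordinate, and both coordinates receive free places alternately. *)
Definition free (n : nat) : nat := n * n + 1.

Lemma free_gt n : (n < free n)%nat.
Proof. unfold free; nia. Qed.

Lemma free_lt m n : (m < n)%nat -> (free m < free n)%nat.
Proof. unfold free; nia. Qed.

Lemma odd_free n : Nat.odd (free n) = negb (Nat.odd n).
Proof. unfold free. rewrite Nat.odd_add, Nat.odd_mul. now destruct (Nat.odd n). Qed.

Definition weight (j : nat) : R := (1/2) ^ Nat.div2 j.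

Lemma weight_pos j : 0 < weight j.
Proof. apply half_pow_pos. Qed.

Lemma div2_le i j : (i <= j)%nat -> (Nat.div2 i <= Nat.div2 j)%nat.
Proof. intros. rewrite !Nat.div2_div. apply Nat.Div0.div_le_mono. lia. Qed.

Lemma weight_le i j : (i <= j)%nat -> weight j <= weight i.
Proof. intros. now apply half_pow_le, div2_le. Qed.

Definition dig (c : bool) (b : nat -> bool) : nat -> bool := fun i => b (2 * i + Nat.b2n c)%nat.

Definition point (b : nat -> bool) : pt := (val (dig false b), val (dig true b)).

Lemma crd_point c b : crd c (point b) = val (dig c b).
Proof. destruct c; reflexivity. Qed.

Lemma dig_div2 j b : dig (Nat.odd j) b (Nat.div2 j) = b j.
Proof. unfold dig. now rewrite <- Nat.div2_odd. Qed.

Lemma div2_dig i c : Nat.div2 (2 * i + Nat.b2n c) = i /\ Nat.odd (2 * i + Nat.b2n c) = c.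
Proof.
  split.
  - rewrite Nat.div2_div. symmetry. apply (Nat.div_unique _ _ _ (Nat.b2n c)); [|reflexivity].
    destruct c; simpl; lia.
  - rewrite Nat.odd_add, Nat.odd_mul. destruct c; reflexivity.
Qed.

Lemma val_dig_upd c b k v : val (dig c (upd b k v)) =
  val (dig c b) + (if Bool.eqb (Nat.odd k) c then (b2r v - b2r (b k)) * weight k else 0).
Proof.
  destruct (Bool.eqb (Nat.odd k) c) eqn:E.
  - apply Bool.eqb_prop in E. subst c. rewrite <- (dig_div2 k b). unfold weight.
    rewrite <- val_upd. apply val_ext. intros i. unfold dig, upd.
    pose proof (Nat.div2_odd k) as Hk. pose proof (div2_dig i (Nat.odd k)) as [Hi _].
    destruct (Nat.eq_dec (2 * i + Nat.b2n (Nat.odd k)) k) as [e|e], (Nat.eq_dec i (Nat.div2 k)) as [e'|e'];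
      try reflexivity; exfalso; [apply e'; rewrite <- e at 1; auto | apply e; subst i; lia].
  - rewrite Rplus_0_r. apply val_ext. intros i. unfold dig, upd.
    destruct (Nat.eq_dec (2 * i + Nat.b2n c) k) as [e|]; [|reflexivity].
    pose proof (div2_dig i c) as [_ h]. rewrite e in h. rewrite h, Bool.eqb_reflx in E. discriminate.
Qed.

Lemma point_separated j k b b' : (j < k)%nat -> Nat.odd j = Nat.odd k ->
  b k = false -> b' k = false -> b j <> b' j ->
  weight k <= Rabs (val (dig (Nat.odd j) b) - val (dig (Nat.odd j) b')).
Proof.
  intros Hjk Hp Hk Hk' Hne. apply (val_separated _ (Nat.div2 j)).
  - pose proof (Nat.div2_odd j). pose proof (Nat.div2_odd k). rewrite Hp in *. lia.
  - rewrite Hp, dig_div2. exact Hk.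
  - rewrite Hp, dig_div2. exact Hk'.
  - now rewrite !dig_div2.
Qed.

(** [h] decodes digit [j] from the coordinate that contains it. The last clause covers all sequences
    vanishing at the single place [k], because during the process the earlier free places are
    already filled. *)
Definition reads (j k : nat) (h : R -> R) : Prop :=
  (forall x, 0 <= h x <= 1) /\
  (forall x y, Rabs (h x - h y) <= / weight k * Rabs (x - y)) /\
  (forall b, b k = false -> h (val (dig (Nat.odd j) b)) = b2r (b j)).

Definition read (j k : nat) : R -> R := epsilon (inhabits (fun _ => 0)) (reads j k).

Lemma read_spec j k : (j < k)%nat -> Nat.odd j = Nat.odd k -> reads j k (read j k).
Proof.
  intros Hjk Hp. unfold read. apply epsilon_spec.
  destruct (lipschitz_separation (fun x => exists b, b k = false /\ b j = false /\
    x = val (dig (Nat.odd j) b)) (weight k) (weight_pos k)) as (h & Hr & Hl & H0 & H1).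
  exists h. split; [exact Hr|]. split; [exact Hl|]. intros b Hb.
  destruct (b j) eqn:Hj.
  - apply H1. intros z (b' & Hk' & Hj' & ->).
    apply point_separated; trivial. congruence.
  - apply H0. now exists b.
Qed.

(* Shear [2n] copies digit [n] to place [free n], which belongs to the other coordinate;
   shear [2n+1] uses that copy to erase digit [n]. *)
Definition dir (m : nat) : bool :=
  let n := Nat.div2 m in if Nat.odd m then Nat.odd n else Nat.odd (free n).

(** The guard place must lie beyond the digit that is read, in the same coordinate, and still be
    empty: [free (n + 1)] has the parity of [n], and [free (n + 2)] that of [free n]. *)
Definition prof (m : nat) (z : R) : R :=
  let n := Nat.div2 m in
  if Nat.odd m then - weight n * read (free n) (free (n + 2)) z
  else weight (free n) * read n (free (n + 1)) z.

Definition amplitude (m : nat) : R := weight (Nat.div2 m).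

Definition prof_lip (m : nat) : R :=
  let n := Nat.div2 m in
  if Nat.odd m then weight n * / weight (free (n + 2)) else weight (free n) * / weight (free (n + 1)).

Lemma copy_reads n : reads n (free (n + 1)) (read n (free (n + 1))).
Proof.
  apply read_spec.
  - pose proof (free_gt (n + 1)). lia.
  - rewrite odd_free, Nat.odd_add. now destruct (Nat.odd n).
Qed.

Lemma erase_reads n : reads (free n) (free (n + 2)) (read (free n) (free (n + 2))).
Proof.
  apply read_spec.
  - apply free_lt; lia.
  - rewrite !odd_free, Nat.odd_add. now destruct (Nat.odd n).
Qed.

Lemma prof_bound m z : Rabs (prof m z) <= amplitude m.
Proof.
  unfold prof, amplitude. destruct (Nat.odd m); rewrite Rabs_mult, ?Rabs_Ropp.
  - destruct (erase_reads (Nat.div2 m)) as [H _]. specialize (H z).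
    pose proof (weight_pos (Nat.div2 m)). rewrite !Rabs_pos_eq; nra.
  - destruct (copy_reads (Nat.div2 m)) as [H _]. specialize (H z).
    pose proof (weight_pos (free (Nat.div2 m))).
    pose proof (weight_le (Nat.div2 m) (free (Nat.div2 m)) ltac:(pose proof (free_gt (Nat.div2 m)); lia)).
    rewrite !Rabs_pos_eq; nra.
Qed.

Lemma prof_lipschitz m z z' : Rabs (prof m z - prof m z') <= prof_lip m * Rabs (z - z').
Proof.
  unfold prof, prof_lip. destruct (Nat.odd m); rewrite <- Rmult_minus_distr_l, Rabs_mult, ?Rabs_Ropp,
    (Rabs_pos_eq (weight _)), Rmult_assoc by (left; apply weight_pos);
    (apply Rmult_le_compat_l; [left; apply weight_pos|]).
  - apply erase_reads.
  - apply copy_reads.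
Qed.

Lemma speed_summable : ex_series (fun m => amplitude m / tau m).
Proof.
  (* The number 0.855 is 0.9 times 0.95, and its fourth power exceeds 1/2. As [amplitude m] is 1/2
     to the integer part of [m / 4], it is at most [x ^ m / x ^ 3]; division by [tau m] leaves a
     multiple of [(95/100) ^ m]. *)
  set (x := 855/1000).
  apply (ex_series_dom _ (fun m => 10 / x ^ 3 * (95/100) ^ m)).
  2:{ apply ex_series_Rscal, ex_series_geom. rewrite Rabs_pos_eq; lra. }
  intros m. assert (Hx : 0 < x < 1) by (unfold x; lra).
  assert (Hq : x ^ m = ratio ^ m * (95/100) ^ m).
  { rewrite <- Rpow_mult_distr. f_equal. unfold x, ratio; field. }
  assert (Hw : amplitude m <= x ^ m / x ^ 3).
  { unfold amplitude, weight. set (k := Nat.div2 (Nat.div2 m)).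
    assert (Hm : exists r, (r <= 3)%nat /\ m = (4 * k + r)%nat).
    { pose proof (Nat.div2_odd m) as H1. pose proof (Nat.div2_odd (Nat.div2 m)) as H2. fold k in H2.
      exists (m - 4 * k)%nat. destruct (Nat.odd m), (Nat.odd (Nat.div2 m)); simpl in *; lia. }
    clearbody k. destruct Hm as [r [Hr ->]]. rewrite pow_add, pow_mult.
    assert (H4 : (1/2) ^ k <= (x ^ 4) ^ k) by (apply pow_incr; unfold x; lra).
    assert (H3 : x ^ 3 <= x ^ r).
    { clear -Hx Hr. assert (0 < x ^ 2) by (apply pow_lt; lra).
      destruct r as [|[|[|[|r]]]]; [| | | |lia]; simpl in *; nra. }
    assert (0 < x ^ 3) by (apply pow_lt; lra). pose proof (half_pow_pos k).
    apply Rmult_le_reg_r with (x ^ 3); [lra|].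
    unfold Rdiv; rewrite Rmult_assoc, Rinv_l, Rmult_1_r by lra.
    apply Rmult_le_compat; lra. }
  pose proof (weight_pos (Nat.div2 m)) as Hp. fold (amplitude m) in Hp.
  pose proof (ratio_pow_pos m). assert (0 < x ^ 3) by (apply pow_lt; lra).
  rewrite Rabs_pos_eq.
  2:{ pose proof (Rinv_0_lt_compat _ (tau_pos m)). unfold Rdiv; nra. }
  apply Rmult_le_reg_r with (tau m); [apply tau_pos|].
  pose proof (tau_pos m). unfold Rdiv at 1. rewrite Rmult_assoc, Rinv_l, Rmult_1_r by lra.
  eapply Rle_trans; [exact Hw|]. rewrite Hq. unfold tau. right. field. lra.
Qed.

Lemma odd_double n : Nat.odd (2 * n) = false /\ Nat.div2 (2 * n) = n /\
  Nat.odd (S (2 * n)) = true /\ Nat.div2 (S (2 * n)) = n.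
Proof.
  pose proof (div2_dig n false) as [H1 H2]. pose proof (div2_dig n true) as [H3 H4].
  cbn [Nat.b2n] in *. rewrite Nat.add_0_r in *. rewrite Nat.add_1_r in *. auto.
Qed.

(** The guard digit makes the reading exact, and the target place is empty, so adding its weight
    sets one digit without any carry. *)
Lemma shear_copy n b : b (free n) = false -> b (free (n + 1)) = false ->
  shear dir prof (2 * n) 1 (point b) = point (upd b (free n) (b n)).
Proof.
  intros H1 H2. destruct (odd_double n) as (E1 & E2 & _ & _).
  apply pt_eq. intros c. unfold shear, amount, prof, dir. rewrite E1, E2, crd_mv, !crd_point.
  rewrite val_dig_upd, H1, odd_free, Bool.negb_involutive.
  destruct (copy_reads n) as (_ & _ & ->); [|exact H2].
  destruct Bool.eqb; simpl; ring.
Qed.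

Lemma shear_erase n b : b (free n) = b n -> b (free (n + 2)) = false ->
  shear dir prof (S (2 * n)) 1 (point b) = point (upd b n false).
Proof.
  intros H1 H2. destruct (odd_double n) as (_ & _ & E1 & E2).
  apply pt_eq. intros c. unfold shear, amount, prof, dir. rewrite E1, E2, crd_mv, !crd_point.
  rewrite val_dig_upd, <- odd_free.
  destruct (erase_reads n) as (_ & _ & ->); [|exact H2]. rewrite H1.
  destruct Bool.eqb; simpl; ring.
Qed.

Definition admissible (b : nat -> bool) : Prop := forall m, b (free m) = false.

Fixpoint digits (n : nat) (b : nat -> bool) : nat -> bool :=
  match n with
  | O => b
  | S k => upd (upd (digits k b) (free k) (digits k b k)) k false
  end.

(** The second claim is the invariant behind every reading: free places of index at least [n] have
    not been written yet. A copy is erased later in its turn, since [free n] exceeds [n]. *)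
Lemma digits_spec n b : admissible b ->
  (forall j, (j < n)%nat -> digits n b j = false) /\
  (forall m, (n <= m)%nat -> digits n b (free m) = false).
Proof.
  intros Hb. induction n as [|n [IH1 IH2]].
  - split; [lia | intros; apply Hb].
  - pose proof (free_gt n). split.
    + intros j Hj. simpl. unfold upd at 1. destruct (Nat.eq_dec j n); [reflexivity|].
      unfold upd. destruct (Nat.eq_dec j (free n)); [lia|]. apply IH1; lia.
    + intros m Hm. pose proof (free_gt m). pose proof (free_lt n m Hm).
      simpl. unfold upd. destruct (Nat.eq_dec (free m) n); [reflexivity|].
      destruct (Nat.eq_dec (free m) (free n)); [lia|]. apply IH2; lia.
Qed.

Lemma stage_digits n b : admissible b -> stage dir prof (2 * n) (point b) = point (digits n b).
Proof.
  intros Hb. induction n as [|n IH]; [reflexivity|].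
  replace (2 * S n)%nat with (S (S (2 * n))) by lia. cbn [stage].
  destruct (digits_spec n b Hb) as [_ H]. pose proof (free_gt n).
  pose proof (free_lt n (n + 2) ltac:(lia)).
  rewrite IH, shear_copy, shear_erase; try (apply H; lia); [reflexivity | |].
  - unfold upd. destruct (Nat.eq_dec (free n) (free n)); [|lia].
    destruct (Nat.eq_dec n (free n)); [lia | reflexivity].
  - unfold upd. destruct (Nat.eq_dec (free (n + 2)) (free n)); [lia|]. apply H; lia.
Qed.

Lemma flow_collapse b : admissible b -> flow dir prof 1 (point b) = origin.
Proof.
  intros Hb. apply pt_eq. intros c. replace (crd c origin) with 0 by (destruct c; reflexivity).
  (* After [4n] shears the first [2n] digits vanish, that is, the first [n] digits of each
     coordinate. *)
  assert (Hlim : is_lim_seq (fun n => crd c (stage dir prof (2 * (2 * n)) (point b)))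
    (crd c (flow dir prof 1 (point b)))).
  { apply (is_lim_seq_subseq (fun m => crd c (stage dir prof m (point b)))).
    - intros P [N HN]. exists N. intros n Hn. apply HN. lia.
    - apply (flow_terminal dir prof amplitude); [exact prof_bound | exact speed_summable]. }
  assert (H0 : is_lim_seq (fun n => crd c (stage dir prof (2 * (2 * n)) (point b))) 0).
  { apply is_lim_seq_le_le with (fun _ => 0) (fun n => 2 * (1/2) ^ n).
    - intros n. rewrite stage_digits, crd_point by exact Hb. split; [apply val_range|].
      apply val_small. intros i Hi. unfold dig. apply digits_spec; [exact Hb|].
      destruct c; simpl; lia.
    - apply is_lim_seq_const.
    - replace (Finite 0) with (Rbar_mult 2 0) by (simpl; f_equal; ring).
      apply is_lim_seq_scal_l, is_lim_seq_geom. rewrite Rabs_pos_eq; lra. }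
  apply is_lim_seq_unique in Hlim. apply is_lim_seq_unique in H0. congruence.
Qed.

(** * Compactness *)

Definition cantor (p : pt) : Prop := exists b, admissible b /\ point b = p.

Definition agree (k : nat) (b c : nat -> bool) : Prop := forall i, (i < k)%nat -> b i = c i.

Lemma point_close n b b' : agree (2 * n) b b' -> dist2 (point b) (point b') <= 4 * (1/2) ^ n.
Proof.
  intros H. eapply Rle_trans; [apply dist2_le_dist1|]. unfold dist1; simpl fst; simpl snd.
  assert (Hc : forall c, Rabs (val (dig c b) - val (dig c b')) <= 2 * (1/2) ^ n).
  { intros c. apply val_close. intros i Hi. apply H. destruct c; simpl; lia. }
  pose proof (Hc false). pose proof (Hc true). lra.
Qed.

Section Koenig.

Variable covered : nat -> (nat -> bool) -> Prop.
Hypothesis covered_split : forall k c,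
  covered (S k) (upd c k true) -> covered (S k) (upd c k false) -> covered k c.

Fixpoint uncovered_prefix (k : nat) : nat -> bool :=
  match k with
  | O => fun _ => false
  | S k => upd (uncovered_prefix k) k
      (if excluded_middle_informative (covered (S k) (upd (uncovered_prefix k) k true)) then false else true)
  end.

(** If a prefix is uncovered, so is one of its two extensions. Following uncovered extensions fixes
    one digit at a time and defines an infinite branch. *)
Lemma bad_branch : ~ covered 0 (fun _ => false) ->
  exists b, forall k, exists c, agree k c b /\ ~ covered k c.
Proof.
  intros H0. exists (fun k => uncovered_prefix (S k) k). intros k. exists (uncovered_prefix k). split.
  - induction k as [|k IH]; intros i Hi; [lia|].
    destruct (Nat.eq_dec i k) as [->|n]; [reflexivity|].
    rewrite <- IH by lia. simpl. unfold upd. now destruct (Nat.eq_dec i k).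
  - induction k as [|k IH]; [exact H0|]. simpl.
    destruct excluded_middle_informative as [h|h]; [|exact h].
    intros h'. apply IH. now apply covered_split.
Qed.

End Koenig.

(** Bisection on digits: without a finite subcover, some branch has no finitely covered cylinder,
    yet an open set around its point contains a whole cylinder. *)
Lemma cantor_compact : compact2 cantor.
Proof.
  intros I O HO Hcov.
  set (covered := fun k c => exists l : list I, forall b, admissible b -> agree k b c ->
    exists i, In i l /\ O i (point b)).
  destruct (classic (covered 0%nat (fun _ => false))) as [[l Hl]|Hn].
  { exists l. intros p (b & Hb & <-). apply Hl; [exact Hb|]. intros i Hi; lia. }
  exfalso. destruct (bad_branch covered) with (2 := Hn) as [b Hb].
  { intros k c [l Hl] [l' Hl']. exists (l ++ l'). intros b Hb Hag.
    assert (Hu : agree (S k) b (upd c k (b k))).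
    { intros i Hi. unfold upd. destruct (Nat.eq_dec i k) as [->|]; [reflexivity | apply Hag; lia]. }
    destruct (b k); [destruct (Hl b Hb Hu) as (i & Hi & Ho) | destruct (Hl' b Hb Hu) as (i & Hi & Ho)];
      exists i; rewrite in_app_iff; auto. }
  (* If [b] had a 1 at a free place, the cylinder just past that place would contain no admissible
     sequence, and the empty list would cover it. *)
  assert (Hadm : admissible b).
  { intros m. destruct (b (free m)) eqn:E; [|reflexivity]. exfalso.
    destruct (Hb (S (free m))) as (c & Hag & Hnc). apply Hnc. exists nil. intros b' Hb' Hag'.
    specialize (Hag (free m) ltac:(lia)). specialize (Hag' (free m) ltac:(lia)).
    rewrite (Hb' m) in Hag'. congruence. }
  destruct (Hcov (point b)) as [i Hi]; [now exists b|].
  destruct (HO i _ Hi) as (r & Hr & Hball).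
  destruct (pow_lt_1_zero (1/2)) with (y := r / 4) as [n Hn']; [rewrite Rabs_pos_eq; lra | lra |].
  specialize (Hn' n (le_n n)). rewrite Rabs_pos_eq in Hn' by (left; apply half_pow_pos).
  destruct (Hb (2 * n)%nat) as (c & Hag & Hnc). apply Hnc.
  exists (i :: nil). intros b' Hb' Hag'. exists i. split; [now left|]. apply Hball.
  eapply Rle_lt_trans; [apply (point_close n)|lra].
  intros j Hj. rewrite Hag' by exact Hj. symmetry. now apply Hag.
Qed.

(** * Counting cylinders *)

(* [cyl o k] is the measure of a cylinder of depth [k] when the digits off [o] are forced to vanish. *)
Fixpoint cyl (o : nat -> bool) (k : nat) : R :=
  match k with O => 1 | S k => (if o O then 1/2 else 1) * cyl (drop1 o) k end.

Lemma cyl_pos k : forall o, 0 < cyl o k.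
Proof.
  induction k as [|k IH]; intros o; simpl; [lra|]. specialize (IH (drop1 o)). destruct (o O); lra.
Qed.

Lemma cyl_S k : forall o, cyl o (S k) = cyl o k * (if o k then 1/2 else 1).
Proof.
  induction k as [|k IH]; intros o; [simpl; ring|].
  change (cyl o (S (S k))) with ((if o O then 1/2 else 1) * cyl (drop1 o) (S k)).
  rewrite IH. unfold drop1 at 2. simpl. ring.
Qed.

Fixpoint total (o : nat -> bool) (l : list ((nat -> bool) * nat)) : R :=
  match l with nil => 0 | ck :: l => cyl o (snd ck) + total o l end.

Lemma total_pos o l : 0 <= total o l.
Proof. induction l as [|ck l IH]; simpl; [lra|]. pose proof (cyl_pos (snd ck) o). lra. Qed.

Lemma total_ge o l ck : In ck l -> cyl o (snd ck) <= total o l.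
Proof.
  induction l as [|x l IH]; simpl; [tauto|].
  pose proof (total_pos o l). pose proof (cyl_pos (snd x) o).
  intros [->|H1]; [lra | specialize (IH H1); lra].
Qed.

Lemma total_app o l l' : total o (l ++ l') = total o l + total o l'.
Proof. induction l as [|x l IH]; simpl; [ring | rewrite IH; ring]. Qed.

(** The cylinders in the branch [v], with their first digit deleted: one step down the binary
    tree. *)
Definition restrict (v : bool) (l : list ((nat -> bool) * nat)) : list ((nat -> bool) * nat) :=
  map (fun ck => (drop1 (fst ck), pred (snd ck))) (filter (fun ck => Bool.eqb (fst ck O) v) l).

Lemma total_restrict o l : (forall ck, In ck l -> snd ck <> O) ->
  total o l = (if o O then 1/2 else 1) *
    (total (drop1 o) (restrict true l) + total (drop1 o) (restrict false l)).
Proof.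
  induction l as [|[c k] l IH]; intros H; [simpl; ring|].
  unfold restrict in *. simpl total at 1. rewrite IH by (intros; apply H; now right).
  specialize (H (c, k) (or_introl eq_refl)). simpl in H. destruct k as [|k]; [congruence|].
  simpl. destruct (c O); simpl; ring.
Qed.

(** Subadditivity of the measure, proved as a Kraft inequality by induction on the maximal depth. A
    cylinder of depth 0 has mass 1; otherwise the family splits by first digit and each admissible
    branch is covered. *)
Lemma cylinders_cover K : forall o l,
  (forall ck, In ck l -> (snd ck <= K)%nat) ->
  (forall b, (forall i, o i = false -> b i = false) ->
    exists ck, In ck l /\ agree (snd ck) b (fst ck)) ->
  1 <= total o l.
Proof.
  induction K as [|K IH]; intros o l HK Hcov.
  - destruct (Hcov (fun _ => false)) as (ck & Hin & _); [reflexivity|].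
    pose proof (total_ge o l ck Hin). specialize (HK ck Hin).
    replace (snd ck) with O in H by lia. exact H.
  - destruct (classic (exists ck, In ck l /\ snd ck = O)) as [(ck & Hin & Hz)|Hnz].
    { pose proof (total_ge o l ck Hin). rewrite Hz in H. exact H. }
    assert (Hnz' : forall ck, In ck l -> snd ck <> O) by (intros ck h1 h2; apply Hnz; eauto).
    rewrite total_restrict by exact Hnz'.
    assert (Hr : forall v, (o O = false -> v = false) -> 1 <= total (drop1 o) (restrict v l)).
    { intros v Hv. apply IH.
      - intros ck Hin. unfold restrict in Hin. apply in_map_iff in Hin.
        destruct Hin as (x & <- & Hx). apply filter_In in Hx. simpl. specialize (HK x (proj1 Hx)). lia.
      - intros b Hb.
        destruct (Hcov (fun i => match i with O => v | S i => b i end)) as ([c k] & Hin & Hag).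
        { intros [|i] Hi; [now apply Hv | now apply Hb]. }
        specialize (Hnz' _ Hin). simpl in *. destruct k as [|k]; [congruence|].
        exists (drop1 c, k). split.
        + apply in_map_iff. exists (c, S k). split; [reflexivity|]. apply filter_In.
          split; [exact Hin|]. simpl. rewrite <- (Hag O) by lia. apply Bool.eqb_reflx.
        + intros i Hi. simpl in *. apply (Hag (S i)). lia. }
    destruct (o O) eqn:Ho.
    + pose proof (Hr true ltac:(discriminate)). pose proof (Hr false ltac:(reflexivity)). lra.
    (* A forced digit leaves only the zero branch to be covered, and it carries the full mass. *)
    + pose proof (Hr false ltac:(reflexivity)). pose proof (total_pos (drop1 o) (restrict true l)). lra.
Qed.

(** The places that initially carry data; [admissible] means supported on them. *)
Definition occupied (j : nat) : bool :=
  if excluded_middle_informative (exists m, free m = j) then false else true.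

Lemma occupied_free m : occupied (free m) = false.
Proof. unfold occupied. destruct excluded_middle_informative as [|h]; [reflexivity | destruct h; eauto]. Qed.

Lemma occupied_between m j : (free m < j < free (S m))%nat -> occupied j = true.
Proof.
  intros H. unfold occupied. destruct excluded_middle_informative as [[n <-]|]; [|reflexivity].
  exfalso. destruct (lt_eq_lt_dec n m) as [[h|e]|h]; [|subst n|].
  - pose proof (free_lt _ _ h). lia.
  - lia.
  - destruct (Nat.eq_dec n (S m)) as [->|]; [lia|].
    pose proof (free_lt (S m) n ltac:(lia)). lia.
Qed.

Lemma admissible_occupied b : (forall i, occupied i = false -> b i = false) -> admissible b.
Proof. intros H m. apply H, occupied_free. Qed.

(** Of the [n * n + 1] places before [free n], exactly [n] are free; each of the others halves the
    mass. *)
Lemma cyl_free n : cyl occupied (free n) = (1/2) ^ (n * n - n + 1).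
Proof.
  induction n as [|n IH].
  - simpl. replace (occupied O) with true; [ring|]. unfold occupied.
    destruct excluded_middle_informative as [[m h]|]; [unfold free in h; lia | reflexivity].
  - assert (H : forall j, (j <= 2 * n)%nat ->
      cyl occupied (S (free n) + j) = cyl occupied (free n) * (1/2) ^ j).
    { induction j as [|j IHj]; intros Hj.
      - rewrite Nat.add_0_r, cyl_S, occupied_free. simpl. ring.
      - rewrite Nat.add_succ_r, cyl_S, IHj by lia. rewrite (occupied_between n).
        + simpl. ring.
        + unfold free. lia. }
    replace (free (S n)) with (S (free n) + 2 * n)%nat by (unfold free; lia).
    rewrite H, IH by lia. rewrite <- pow_add. f_equal. nia.
Qed.

(** * Hausdorff dimension of the Cantor set *)

Lemma half_pow_exp k : (1/2) ^ k = exp (- (INR k * ln 2)).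
Proof.
  rewrite <- Rpower_pow by lra. unfold Rpower. f_equal.
  replace (1/2) with (/2) by lra. rewrite ln_Rinv by lra. ring.
Qed.

Lemma Rpower_base_le a b s : 0 <= s -> 0 < a <= b -> Rpower a s <= Rpower b s.
Proof.
  intros Hs Hab. unfold Rpower. destruct (Req_dec a b) as [->|]; [lra|].
  assert (ln a < ln b) by (apply ln_increasing; lra).
  destruct (Rle_lt_or_eq_dec (s * ln a) (s * ln b)) as [h|h]; [nra | | rewrite h; lra].
  left; now apply exp_increasing.
Qed.

Lemma exp_le a b : a <= b -> exp a <= exp b.
Proof. intros H. destruct (Req_dec a b) as [->|]; [lra|]. left; apply exp_increasing; lra. Qed.

(** The source of dimension 2: a cylinder of depth [free n] has mass 2 to the power -(n^2 - n + 1),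
    while its scale is about 2 to the power -n^2/2. The loss from the forced digits is linear in
    [n], hence negligible for [s < 2]. *)
Lemma cyl_le_Rpower s : 0 <= s < 2 -> exists N0, forall n D, (N0 <= n)%nat ->
  weight (free (n + 2)) <= D -> cyl occupied (free n) <= Rpower D s.
Proof.
  (* The linear error is at most 5n + 4, hence at most 9n for [n] at least 1; it must not exceed (1
     - s/2) n^2. *)
  intros Hs. destruct (INR_unbounded (9 / (1 - s / 2))) as [N0 HN0].
  exists (S N0). intros n D Hn HD.
  apply Rle_trans with (Rpower (weight (free (n + 2))) s).
  2:{ apply Rpower_base_le; [lra|]. split; [apply weight_pos | exact HD]. }
  rewrite cyl_free. unfold weight, Rpower. rewrite !half_pow_exp, ln_exp. apply exp_le.
  assert (Hp : INR (Nat.div2 (free (n + 2))) <= (INR n * INR n + 4 * INR n + 5) / 2).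
  { pose proof (Nat.div2_odd (free (n + 2))) as H. apply (f_equal INR) in H.
    rewrite plus_INR, mult_INR in H. unfold free in H at 1.
    rewrite !plus_INR, mult_INR, !plus_INR in H. simpl (INR 2) in H. simpl (INR 1) in H.
    pose proof (pos_INR (Nat.b2n (Nat.odd (free (n + 2))))). nra. }
  assert (He : INR (n * n - n + 1) = INR n * INR n - INR n + 1).
  { rewrite plus_INR, minus_INR by nia. rewrite mult_INR. simpl. ring. }
  rewrite He. set (p := INR (Nat.div2 (free (n + 2)))) in *. set (x := INR n) in *.
  assert (Hx : 9 <= (1 - s / 2) * x /\ 1 <= x).
  { assert (INR N0 + 1 <= x) by (unfold x; rewrite <- S_INR; now apply le_INR).
    assert (9 / (1 - s / 2) <= x) by lra. split.
    - apply Rmult_le_compat_l with (r := 1 - s / 2) in H0; [|lra].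
      replace ((1 - s / 2) * (9 / (1 - s / 2))) with 9 in H0 by (field; lra). exact H0.
    - pose proof (pos_INR N0). lra. }
  assert (Hsp : s * p <= x * x - x + 1).
  { apply Rle_trans with (s * ((x * x + 4 * x + 5) / 2)); [apply Rmult_le_compat_l; lra|].
    assert (9 * x <= (1 - s / 2) * x * x) by nra. nra. }
  pose proof ln_lt_2. nra.
Qed.

Lemma weight_free_to_0 D : 0 < D -> exists M, weight (free M) <= D.
Proof.
  intros HD. destruct (pow_lt_1_zero (1/2)) with (y := D) as [n Hn]; [rewrite Rabs_pos_eq; lra | lra |].
  exists (2 * n)%nat. specialize (Hn n (le_n n)).
  rewrite Rabs_pos_eq in Hn by (left; apply half_pow_pos).
  apply Rle_trans with (weight (2 * n)); [apply weight_le; pose proof (free_gt (2 * n)); lia|].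
  unfold weight. destruct (odd_double n) as (_ & -> & _). lra.
Qed.

Lemma weight_free_locate N0 D : 0 < D < weight (free (N0 + 1)) ->
  exists n, (N0 <= n)%nat /\ weight (free (n + 2)) <= D < weight (free (n + 1)).
Proof.
  intros [HD HN]. destruct (weight_free_to_0 D HD) as [M HM].
  assert (HM' : weight (free (N0 + 1 + M)) <= D).
  { eapply Rle_trans; [|exact HM]. apply weight_le. destruct (Nat.eq_dec (N0 + 1 + M) M); [lia|].
    pose proof (free_lt M (N0 + 1 + M)). lia. }
  clear HM. induction M as [|M IH]; [rewrite Nat.add_0_r in HM'; lra|].
  destruct (Rle_lt_dec (weight (free (N0 + 1 + M))) D) as [h|h]; [now apply IH|].
  exists (N0 + M)%nat. split; [lia|].
  replace (N0 + M + 2)%nat with (N0 + 1 + S M)%nat by lia.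
  replace (N0 + M + 1)%nat with (N0 + 1 + M)%nat by lia. lra.
Qed.

(** One of [free n] and [free (n + 1)] shares the parity of a given earlier place [j]. The gap it
    opens would keep points differing at [j] apart. *)
Lemma close_points_agree n b b' : admissible b -> admissible b' ->
  dist1 (point b) (point b') < weight (free (n + 1)) -> agree (free n) b b'.
Proof.
  intros Hb Hb' Hd j Hj. apply NNPP; intros Hne.
  assert (Hk : exists m, (n <= m <= n + 1)%nat /\ Nat.odd j = Nat.odd (free m)).
  { destruct (Bool.bool_dec (Nat.odd j) (Nat.odd (free n))) as [e|e].
    - exists n. split; [lia | exact e].
    - exists (n + 1)%nat. split; [lia|]. rewrite odd_free in *. rewrite Nat.odd_add. simpl.
      destruct (Nat.odd j), (Nat.odd n); simpl in *; congruence. }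
  destruct Hk as (m & Hm & Hp).
  assert (Hjm : (j < free m)%nat).
  { destruct (Nat.eq_dec m n) as [->|]; [exact Hj|]. pose proof (free_lt n m ltac:(lia)). lia. }
  pose proof (point_separated j (free m) b b' Hjm Hp (Hb m) (Hb' m) Hne) as Hs.
  assert (Hw : weight (free (n + 1)) <= weight (free m)).
  { apply weight_le. destruct (Nat.eq_dec m (n + 1)) as [->|]; [lia|].
    pose proof (free_lt m (n + 1) ltac:(lia)). lia. }
  unfold dist1, point in Hd. simpl fst in Hd. simpl snd in Hd.
  pose proof (Rabs_pos (val (dig false b) - val (dig false b'))).
  pose proof (Rabs_pos (val (dig true b) - val (dig true b'))).
  destruct (Nat.odd j); lra.
Qed.

Lemma total_seq o (F : nat -> (nat -> bool) * nat) g M :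
  (forall n, cyl o (snd (F n)) <= g n) -> total o (map F (seq 0 M)) <= psum g M.
Proof.
  intros H. induction M as [|M IH]; [simpl; lra|].
  rewrite seq_S, map_app, total_app. simpl. specialize (H M). lra.
Qed.

(** Mass distribution principle: each covering set lies in a cylinder whose mass is at most a
    constant times its diameter bound to the power [s], and the masses must add up to at least 1. *)
Lemma cantor_not_null s : 0 <= s < 2 -> ~ Hausdorff_null s cantor.
Proof.
  intros Hs Hnull. destruct (cyl_le_Rpower s Hs) as [N0 HN0].
  set (w0 := weight (free (N0 + 1))). assert (Hw0 : 0 < w0) by apply weight_pos.
  assert (H4 : 0 < Rpower 4 s) by apply exp_pos.
  (* Diameters up to [w0 / 8] keep [4 * d n] below [w0], where scales can be located; the bound on
     the sum makes the total mass at most 1/2. *)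
  destruct (Hnull (w0 / 8) (/ (2 * Rpower 4 s))) as (U & d & Hd & HU & Hsum); [lra | |].
  { apply Rinv_0_lt_compat. lra. }
  (* Thickening by [d n] makes the covering sets open, so finitely many suffice. Points of one
     thickened set are within [4 * d n] in [dist1]: [d n] at each end, and [2 * d n] in between. *)
  set (O := fun n p => exists p', U n p' /\ dist1 p p' < d n).
  destruct (cantor_compact nat O) as [l Hl].
  - intros n p (p' & Hp' & Hlt). exists ((d n - dist1 p p') / 2). split; [lra|].
    intros q Hq. exists p'. split; [exact Hp'|].
    pose proof (dist1_triangle q p p'). rewrite (dist1_sym q p) in H.
    pose proof (dist1_le_dist2 p q). lra.
  - intros p Hp. destruct (HU p Hp) as [n Hn]. exists n, p. split; [exact Hn|].
    unfold dist1. rewrite !Rminus_diag, Rabs_R0. destruct (Hd n) as [? _]. lra.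
  - assert (HF : forall n, exists ck : (nat -> bool) * nat,
      (forall b, admissible b -> O n (point b) -> agree (snd ck) b (fst ck)) /\
      cyl occupied (snd ck) <= Rpower (4 * d n) s).
    { intros n. destruct (Hd n) as [Hdn Hdiam].
      destruct (weight_free_locate N0 (4 * d n)) as (m & Hm & Hw); [fold w0; lra|].
      destruct (classic (exists b, admissible b /\ O n (point b))) as [(c & Hc & p & Hp & Hcp)|Hno].
      - exists (c, free m). split.
        + intros b Hb (p' & Hp' & Hbp'). apply close_points_agree; [exact Hb | exact Hc|].
          pose proof (dist1_triangle (point b) p' (point c)).
          pose proof (dist1_triangle p' p (point c)). rewrite (dist1_sym p (point c)) in H0.
          pose proof (dist1_le_dist2 p' p). pose proof (Hdiam p' p Hp' Hp). simpl fst. lra.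
        + apply HN0; [exact Hm | lra].
      (* A set that misses the Cantor set receives an arbitrary cylinder of the right depth, which
         preserves the mass bound. *)
      - exists (fun _ => false, free m). split.
        + intros b Hb Hob. destruct Hno. eauto.
        + apply HN0; [exact Hm | lra]. }
    set (F := fun n => proj1_sig (constructive_indefinite_description _ (HF n))).
    assert (HF' : forall n, (forall b, admissible b -> O n (point b) -> agree (snd (F n)) b (fst (F n))) /\
      cyl occupied (snd (F n)) <= Rpower 4 s * Rpower (d n) s).
    { intros n. unfold F. destruct constructive_indefinite_description as [ck [H1 H2]]. simpl.
      split; [exact H1|]. rewrite Rpower_mult_distr; [exact H2 | lra | apply Hd]. }
    set (M := S (list_max l)).
    assert (H1 : 1 <= total occupied (map F (seq 0 M))).
    { apply (cylinders_cover (list_max (map snd (map F (seq 0 M))))).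
      - intros ck Hin. pose proof (list_max_le (map snd (map F (seq 0 M)))
          (list_max (map snd (map F (seq 0 M))))) as [h _]. specialize (h (le_n _)).
        rewrite Forall_forall in h. apply h. now apply in_map.
      - intros b Hb. apply admissible_occupied in Hb.
        destruct (Hl (point b)) as (n & Hn & Ho); [now exists b|].
        exists (F n). split; [|now apply (HF' n)].
        apply in_map, in_seq. unfold M.
        pose proof (list_max_le l (list_max l)) as [h _]. specialize (h (le_n _)).
        rewrite Forall_forall in h. specialize (h n Hn). lia. }
    pose proof (total_seq occupied F (fun n => Rpower 4 s * Rpower (d n) s) M
      (fun n => proj2 (HF' n))) as H2.
    rewrite psum_scal in H2. specialize (Hsum (list_max l)). rewrite sum_f_R0_psum in Hsum.
    fold M in Hsum. apply Rmult_le_compat_l with (r := Rpower 4 s) in Hsum; [|lra].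
    replace (Rpower 4 s * / (2 * Rpower 4 s)) with (1/2) in Hsum by (field; lra). lra.
Qed.

(** Preimages of the covering sets cover [A], with diameters enlarged by [2 * K]; the factor 2 pays
    for the passage between [dist1] and [dist2]. *)
Lemma Hausdorff_null_pullback s (g : pt -> pt) (A : pt -> Prop) K : 0 < K ->
  (forall a b, dist1 a b <= K * dist1 (g a) (g b)) ->
  Hausdorff_null s (image2 g A) -> Hausdorff_null s A.
Proof.
  intros HK Hg Hnull delta eps Hdelta Heps.
  assert (HP : 0 < Rpower (2 * K) s) by apply exp_pos.
  destruct (Hnull (delta / (2 * K)) (eps / Rpower (2 * K) s)) as (U & d & Hd & HU & Hsum).
  { apply Rdiv_lt_0_compat; lra. }
  { now apply Rdiv_lt_0_compat. }
  exists (fun n p => U n (g p)), (fun n => 2 * K * d n). split; [|split].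
  - intros n. destruct (Hd n) as [Hdn Hdiam]. split.
    + split; [nra|]. replace delta with (2 * K * (delta / (2 * K))) by (field; lra).
      apply Rmult_le_compat_l; lra.
    + intros p p' Hp Hp'. eapply Rle_trans; [apply dist2_le_dist1|].
      eapply Rle_trans; [apply Hg|]. pose proof (dist1_le_dist2 (g p) (g p')).
      pose proof (Hdiam _ _ Hp Hp'). nra.
  - intros p Hp. apply HU. now exists p.
  - intros N. specialize (Hsum N). rewrite sum_f_R0_psum in *.
    rewrite (psum_ext _ (fun n => Rpower (2 * K) s * Rpower (d n) s)).
    + rewrite psum_scal. apply Rmult_le_compat_l with (r := Rpower (2 * K) s) in Hsum; [|lra].
      replace (Rpower (2 * K) s * (eps / Rpower (2 * K) s)) with eps in Hsum by (field; lra). exact Hsum.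
    + intros m _. symmetry. apply Rpower_mult_distr; [lra | apply Hd].
Qed.

(** * Upper bound for the dimension by square grids *)

Lemma grid_index h N : forall a x, a <= x <= a + INR N * h -> (0 < N)%nat ->
  exists i, (i < N)%nat /\ a + INR i * h <= x <= a + INR i * h + h.
Proof.
  induction N as [|N IH]; intros a x Hx HN; [lia|].
  destruct (Rle_lt_dec (a + INR N * h) x) as [Hlt|Hlt].
  - exists N. split; [lia|]. rewrite S_INR in Hx. lra.
  - destruct (Nat.eq_dec N 0) as [->|]; [simpl in Hlt; lra|].
    destruct (IH a x) as (i & Hi & Hi'); [lra | lia|]. exists i. split; [lia | exact Hi'].
Qed.

Lemma psum_indicator K M : psum (fun n => if lt_dec n K then 1 else 0) M <= INR K.
Proof.
  assert (H : psum (fun n => if lt_dec n K then 1 else 0) M <= INR (min M K)).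
  { induction M as [|M IH]; [simpl; lra|]. simpl psum. destruct (lt_dec M K).
    - replace (min (S M) K) with (S (min M K)) by lia. rewrite S_INR. lra.
    - replace (min (S M) K) with (min M K) by lia. lra. }
  eapply Rle_trans; [exact H|]. apply le_INR. lia.
Qed.

Lemma psum_half M : psum (fun n => (1/2) ^ n) M <= 2.
Proof.
  assert (H : psum (fun n => (1/2) ^ n) M = 2 - 2 * (1/2) ^ M).
  { induction M as [|M IH]; [simpl; ring|]. simpl psum. rewrite IH. simpl. field. }
  pose proof (half_pow_pos M). lra.
Qed.

Lemma Rpower_half_pow_le s n : 1 <= s -> Rpower ((1/2) ^ n) s <= (1/2) ^ n.
Proof.
  intros Hs. unfold Rpower. rewrite half_pow_exp, ln_exp. apply exp_le.
  assert (0 <= INR n * ln 2) by (apply Rmult_le_pos; [apply pos_INR | pose proof ln_lt_2; lra]). nra.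
Qed.

Lemma bounded_null s M (A : pt -> Prop) : 2 < s ->
  (forall p c, A p -> Rabs (crd c p) <= M) -> Hausdorff_null s A.
Proof.
  intros Hs HA.
  assert (HA' : exists M', 0 < M' /\ forall p c, A p -> Rabs (crd c p) <= M').
  { exists (Rabs M + 1). pose proof (Rabs_pos M). pose proof (Rle_abs M). split; [lra|].
    intros p c Hp. specialize (HA p c Hp). lra. }
  clear M HA. destruct HA' as (M & HM & HA). intros delta eps Hdelta Heps.
  (* The 3 comes from [N * N] grid cells plus a padding sum of at most 2, which is at most
     [3 * N * N]. *)
  set (C := 3 * Rpower (4 * M) s). assert (HC : 0 < C) by (apply Rmult_lt_0_compat; [lra | apply exp_pos]).
  (* The three bounds on [N] ensure a mesh finer than [delta], a nonempty grid, and C N^(2-s) at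
     most [eps]. *)
  destruct (INR_unbounded (Rmax (4 * M / delta) (Rmax 1 (exp (ln (C / eps) / (s - 2)))))) as [N HN].
  assert (HN1 : 4 * M / delta <= INR N) by (eapply Rle_trans; [apply Rmax_l | left; exact HN]).
  assert (HN' : Rmax 1 (exp (ln (C / eps) / (s - 2))) <= INR N)
    by (eapply Rle_trans; [apply Rmax_r | left; exact HN]).
  assert (HN2 : 1 <= INR N) by (eapply Rle_trans; [apply Rmax_l | exact HN']).
  assert (HN3 : exp (ln (C / eps) / (s - 2)) <= INR N) by (eapply Rle_trans; [apply Rmax_r | exact HN']).
  clear HN HN'. assert (HNpos : (0 < N)%nat) by (apply INR_lt; simpl; lra).
  set (h := 2 * M / INR N). assert (Hh : 0 < h) by (apply Rdiv_lt_0_compat; lra).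
  set (cell := fun i x => - M + INR i * h <= x <= - M + INR i * h + h).
  set (D := 2 * h).
  assert (HD : D <= delta).
  { unfold D, h. apply Rmult_le_reg_r with (INR N); [lra|].
    replace (2 * (2 * M / INR N) * INR N) with (delta * (4 * M / delta)) by (field; lra).
    apply Rmult_le_compat_l; lra. }
  (* The index [n] encodes a cell by quotient and remainder. Beyond [N * N] the sets are empty, but
     their sizes must be positive, so they decay geometrically. *)
  exists (fun n p => (n < N * N)%nat /\ cell (n / N)%nat (fst p) /\ cell (n mod N)%nat (snd p)),
    (fun n => if lt_dec n (N * N) then D else D * (1/2) ^ n).
  split; [|split].
  - intros n. pose proof (half_pow_pos n). pose proof (half_pow_le 0 n ltac:(lia)). simpl in H0. split.
    + destruct lt_dec; unfold D in *; split; nra.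
    + intros p p' (Hn & H1 & H2) (_ & H1' & H2'). destruct lt_dec; [|lia].
      eapply Rle_trans; [apply dist2_le_dist1|]. unfold dist1, D, cell in *.
      assert (Rabs (fst p - fst p') <= h) by (apply Rabs_le; lra).
      assert (Rabs (snd p - snd p') <= h) by (apply Rabs_le; lra). lra.
  - intros p Hp. assert (Hrange : forall c, - M <= crd c p <= - M + INR N * h).
    { intros c. replace (INR N * h) with (2 * M) by (unfold h; field; lra).
      pose proof (Rabs_def2 (crd c p) (M + 1)). pose proof (HA p c Hp).
      pose proof (Rle_abs (crd c p)). pose proof (Rle_abs (- crd c p)). rewrite Rabs_Ropp in H2. lra. }
    destruct (grid_index h N _ _ (Hrange false) HNpos) as (i & Hi & Hci).
    destruct (grid_index h N _ _ (Hrange true) HNpos) as (j & Hj & Hcj).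
    exists (i * N + j)%nat. split; [nia|].
    replace ((i * N + j) / N)%nat with i by (apply (Nat.div_unique _ _ _ j); lia).
    replace ((i * N + j) mod N)%nat with j by (apply (Nat.mod_unique _ _ i); lia).
    split; assumption.
  - intros K. rewrite sum_f_R0_psum.
    assert (HDs : 0 < Rpower D s) by apply exp_pos.
    apply Rle_trans with (psum (fun n => Rpower D s * ((if lt_dec n (N * N) then 1 else 0) + (1/2) ^ n)) (S K)).
    { apply psum_le. intros n. pose proof (half_pow_pos n). destruct lt_dec; [nra|].
      rewrite <- Rpower_mult_distr by (unfold D; lra).
      pose proof (Rpower_half_pow_le s n ltac:(lra)). nra. }
    rewrite psum_scal.
    assert (Hp : psum (fun n => (if lt_dec n (N * N) then 1 else 0) + (1/2) ^ n) (S K) <= 3 * (INR N * INR N)).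
    { apply Rle_trans with (INR (N * N) + 2).
      - pose proof (psum_indicator (N * N) (S K)). pose proof (psum_half (S K)).
        assert (E : forall u v m, psum (fun n => u n + v n) m = psum u m + psum v m)
          by (intros u v m; induction m as [|m IH]; simpl; [ring | rewrite IH; ring]).
        rewrite E. apply Rplus_le_compat; assumption.
      - rewrite mult_INR. assert (1 * 1 <= INR N * INR N) by (apply Rmult_le_compat; lra). lra. }
    apply Rle_trans with (Rpower D s * (3 * (INR N * INR N))); [apply Rmult_le_compat_l; lra|].
    replace D with (4 * M * / INR N) by (unfold D, h; field; lra).
    rewrite <- Rpower_mult_distr by (try apply Rinv_0_lt_compat; lra).
    replace (Rpower (4 * M) s * Rpower (/ INR N) s * (3 * (INR N * INR N)))
      with (C * (Rpower (/ INR N) s * (INR N * INR N))) by (unfold C; ring).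
    assert (HlnN : exp (ln (INR N)) = INR N) by (apply exp_ln; lra).
    assert (Hpow : Rpower (/ INR N) s * (INR N * INR N) = exp (- ((s - 2) * ln (INR N)))).
    { rewrite <- HlnN at 2 3. unfold Rpower. rewrite ln_Rinv, <- !exp_plus by lra. f_equal. ring. }
    rewrite Hpow.
    assert (Hln : ln (C / eps) <= (s - 2) * ln (INR N)).
    { assert (H0 : ln (C / eps) / (s - 2) <= ln (INR N)).
      { rewrite <- (ln_exp (ln (C / eps) / (s - 2))). apply ln_le; [apply exp_pos | exact HN3]. }
      apply Rmult_le_compat_l with (r := s - 2) in H0; [|lra].
      replace ((s - 2) * (ln (C / eps) / (s - 2))) with (ln (C / eps)) in H0 by (field; lra). exact H0. }
    apply Rle_trans with (C * exp (- ln (C / eps))).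
    + apply Rmult_le_compat_l; [lra|]. apply exp_le. lra.
    + assert (HCe : 0 < C / eps) by now apply Rdiv_lt_0_compat.
      rewrite exp_Ropp, exp_ln by exact HCe. right. field. lra.
Qed.

Lemma dimH_eq_2 M (A : pt -> Prop) : (forall p c, A p -> Rabs (crd c p) <= M) ->
  (forall s, 0 <= s < 2 -> ~ Hausdorff_null s A) -> dimH_eq A 2.
Proof.
  intros HM Hn. split.
  - intros s [Hs Hnull]. apply Rnot_lt_le. intros h. apply (Hn s); [lra | exact Hnull].
  - intros b Hb. apply Rnot_lt_le. intros h.
    (* The exponent midway between 2 and [b] is admissible, which contradicts [b > 2]. *)
    assert (b <= (2 + b) / 2); [|lra]. apply Hb. split; [lra|].
    apply (bounded_null _ M); [lra | exact HM].
Qed.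

Lemma cantor_bounded p c : cantor p -> Rabs (crd c p) <= 2.
Proof.
  intros (b & _ & <-). rewrite crd_point. pose proof (val_range (dig c b)). apply Rabs_le. lra.
Qed.

Theorem theorem2p14 :
  exists (T : R) (V : R -> pt -> pt) (S : pt -> Prop) (X : R -> pt -> pt),
    0 < T /\
    unif_cont_on T V /\
    weakly_div_free T V /\
    compact2 S /\
    dimH_eq S 2 /\
    trajectory_map T V (fun _ => True) X /\
    (forall t, 0 <= t < T -> dimH_eq (image2 (X t) S) 2) /\
    (forall p, image2 (X T) S p <-> p = origin) /\
    (forall t, 0 <= t <= T -> loc_lipschitz_off0 (V t)).
Proof.
  exists 1, (velocity dir prof), cantor, (flow dir prof).
  assert (Hshear : forall t, is_shear_field (velocity dir prof t)).
  { intros t. apply (velocity_is_shear dir prof prof_lip), prof_lipschitz. }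
  split; [lra|]. split; [|split; [|split; [|split; [|split; [|split; [|split]]]]]].
  - apply (velocity_unif_cont dir prof amplitude prof_lip);
      [exact prof_bound | exact prof_lipschitz | exact speed_summable].
  - now apply shear_fields_div_free.
  - exact cantor_compact.
  - apply (dimH_eq_2 2); [exact cantor_bounded | exact cantor_not_null].
  - apply (flow_trajectory dir prof amplitude); [exact prof_bound | exact speed_summable].
  - intros t Ht.
    destruct (flow_displacement dir prof amplitude prof_bound speed_summable) as [C HC].
    apply (dimH_eq_2 (2 + C)).
    + intros p c (a & Ha & <-). pose proof (cantor_bounded a c Ha). specialize (HC c t a).
      replace (crd c (flow dir prof t a))
        with (crd c a + (crd c (flow dir prof t a) - crd c a)) by ring.
      eapply Rle_trans; [apply Rabs_triang | lra].
    + intros s Hs Hnull. apply (cantor_not_null s Hs).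
      destruct (flow_inverse_lipschitz dir prof prof_lip prof_lipschitz t Ht) as (K & HK & HF).
      now apply (Hausdorff_null_pullback s (flow dir prof t) cantor K).
  - intros p. split.
    + intros (a & (b & Hb & <-) & <-). now apply flow_collapse.
    (* The image at time 1 is exactly the origin because the set is inhabited, for instance by the
       zero sequence. *)
    + intros ->. exists (point (fun _ => false)). split.
      * now exists (fun _ => false).
      * now apply flow_collapse.
  - intros t _. now apply shear_field_loc_lipschitz.
Qed.
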